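(* Let $K\subset\mathbb{R}^n$ be a convex body. Let $\mathcal{F}$ denote the set of continuous convex functions on $K$. Let $\mathcal{P}$ denote the set of pairs $(\mu,\nu)$ of Borel probability measures on $K$ that are in convex order, that is, $$\int_K g\,d(\mu-\nu)\leq 0\quad\text{for all }g\in\mathcal{F}.$$ Then the set of extreme points of $\mathcal{P}$ is equal to the set of pairs of the form $$\Big(\delta_x,\sum_{i=1}^{d+1}\lambda_i\delta_{x_i}\Big)$$ where $x=\sum_{i=1}^{d+1}\lambda_ix_i$, $\lambda_i>0$ for $i=1,\dotsc,d+1$, $\sum_{i=1}^{d+1}\lambda_i=1$, $d\leq n$, and moreover $x_1,\dotsc,x_{d+1}\in K$ are affinely independent.
   Context: A convex body is a convex, compact set with non-empty interior. Points are affinely independent if none of them lies in the affine hull of the others. $\delta_x$ is the Dirac measure at $x$. *)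

(* Defs.v *)
From HB Require Import structures.
From mathcomp Require Import all_boot all_order all_algebra.
From mathcomp Require Import all_classical all_reals all_analysis.

Set Implicit Arguments.
Unset Strict Implicit.
Unset Printing Implicit Defensive.

Import Order.TTheory GRing.Theory Num.Theory.
Import numFieldNormedType.Exports.

Local Open Scope classical_set_scope.
Local Open Scope ring_scope.

Definition convex_body (R : realType) (n : nat) (K : set 'rV[R]_n) : Prop :=
  [/\ convex_set K, compact K & K° !=set0].

(* The points [p j] need not be distinct, and [m = 0] is allowed: the empty
   set is its own affine hull, because an empty sum of weights is not 1. *)
Definition affine_hull (R : realType) (n : nat) (A : set 'rV[R]_n) :
    set 'rV[R]_n :=
  [set y | exists (m : nat) (p : 'I_m -> 'rV[R]_n) (w : 'I_m -> R),
    [/\ forall j, A (p j), \sum_(j < m) w j = 1 &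
        y = \sum_(j < m) w j *: p j]].

Definition affinely_independent (R : realType) (n m : nat)
    (p : 'I_m -> 'rV[R]_n) : Prop :=
  forall i, ~ affine_hull [set p j | j in [set j | j != i]] (p i).

Definition borelRn (R : realType) (n : nat) : Type :=
  g_sigma_algebraType (@open 'rV[R]_n).

(* A measure is a total function on sets whose values off the measurable sets
   are unconstrained, so below measures are compared on Borel sets only. *)
Definition borel_prob (R : realType) (n : nat) : Type :=
  probability (borelRn R n) R.

(* A Borel probability measure on the (closed) set [K] is represented by its
   extension to R^n, i.e. a Borel probability measure giving [K] mass 1.
   The convexity and continuity of [g] and the integrals only involve the
   restriction of [g] to [K]; the integrals are finite as [K] is compact. *)
Definition convex_order_pairs (R : realType) (n : nat) (K : set 'rV[R]_n) :
    set (borel_prob R n * borel_prob R n) :=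
  [set p : borel_prob R n * borel_prob R n |
   [/\ p.1 K = 1%E, p.2 K = 1%E &
    forall g : 'rV[R]_n -> R,
      {within K, continuous g} -> convex_function K g ->
      (\int[p.1]_(x in (K : set (borelRn R n))) (g x)%:E
       - \int[p.2]_(x in (K : set (borelRn R n))) (g x)%:E <= 0)%E]].

Definition pair_eq (R : realType) (n : nat)
    (p q : borel_prob R n * borel_prob R n) : Prop :=
  forall A : set (borelRn R n), measurable A -> p.1 A = q.1 A /\ p.2 A = q.2 A.

(* [p = t q + (1 - t) r] componentwise. *)
Definition pair_mixture (R : realType) (n : nat) (t : R)
    (q r p : borel_prob R n * borel_prob R n) : Prop :=
  forall A : set (borelRn R n), measurable A ->
    (p.1 A = t%:E * q.1 A + (1 - t)%:E * r.1 A)%E /\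
    (p.2 A = t%:E * q.2 A + (1 - t)%:E * r.2 A)%E.

Definition extreme_pairs (R : realType) (n : nat)
    (C : set (borel_prob R n * borel_prob R n)) :
    set (borel_prob R n * borel_prob R n) :=
  [set p : borel_prob R n * borel_prob R n | C p /\
    forall (t : R) (q r : borel_prob R n * borel_prob R n),
      0 < t -> t < 1 -> C q -> C r -> pair_mixture t q r p ->
      pair_eq q p /\ pair_eq r p].

Definition simplex_pairs (R : realType) (n : nat) (K : set 'rV[R]_n) :
    set (borel_prob R n * borel_prob R n) :=
  [set p : borel_prob R n * borel_prob R n |
    exists (d : nat) (x : 'rV[R]_n) (xs : 'I_d.+1 -> 'rV[R]_n)
      (l : 'I_d.+1 -> R),
    [/\ (d <= n)%N, forall i, K (xs i) & affinely_independent xs] /\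
    [/\ forall i, 0 < l i, \sum_(i < d.+1) l i = 1 &
        x = \sum_(i < d.+1) l i *: xs i] /\
    forall A : set (borelRn R n), measurable A ->
      p.1 A = \d_(x : borelRn R n) A /\
      (p.2 A = \sum_(i < d.+1) (l i)%:E * \d_(xs i : borelRn R n) A)%E].

(* Main.v *)
Require Import Defs.
From HB Require Import structures.
From mathcomp Require Import all_boot all_order all_algebra.
From mathcomp Require Import all_classical all_reals all_analysis.
From mathcomp Require Import measurable_realfun ring lra.

Set Implicit Arguments.
Unset Strict Implicit.
Unset Printing Implicit Defensive.

Import Order.TTheory GRing.Theory Num.Theory.
Import numFieldNormedType.Exports.

Local Open Scope classical_set_scope.
Local Open Scope ring_scope.

(* Let (mu, nu) be extreme.  For a Borel set A write mu = mu1 + mu2 with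
   mu1 = mu|A.  By Hahn-Banach there is a linear functional L on the bounded
   Borel functions with 0 <= L <= nu, mu1 <= L and mu2 <= nu - L in convex
   order; being dominated by nu, L is a measure nu1, so that (mu, nu) is a
   mixture of the normalisations of (mu1, nu1) and (mu2, nu - nu1), and
   extremality forces mu(A) to be 0 or 1.  Hence mu is the Dirac measure at the
   barycentre x of nu.  By Jensen's inequality (delta_x, nu') is in convex order
   as soon as nu' lives on K and has barycentre x.  A bounded h with
   int h dnu = 0 and int h(y) y dnu = 0 therefore vanishes nu-almost everywhere,
   as nu is the midpoint of the measures (1 +- eps h) nu.  These are n + 1 linear
   conditions on h, so there are at most n + 1 disjoint sets of positive measure:
   nu is carried by at most n + 1 points, and an affine dependence between them
   would give such an h.  Conversely, both marginals of a component of a simplex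
   pair are carried by the same points, and affine independence determines the
   weights. *)

(** * The Hahn-Banach theorem for sublinear functionals *)

Section HahnBanach.
Variables (R : realType) (V : lmodType R) (D : set V).
Hypothesis DD : forall u v, D u -> D v -> D (u + v).
Hypothesis DZ : forall (t : R) u, D u -> D (t *: u).

(** An infimum inherits an inequality more directly than an equality, so homogeneity is asked as an
    inequality for positive [t]; [sublinearZ] recovers the equality by applying it to [t^-1] as
    well. *)
Definition sublinear_on (p : V -> R) : Prop :=
  (forall u v, D u -> D v -> p (u + v) <= p u + p v) /\
  (forall (t : R) u, 0 < t -> D u -> p (t *: u) <= t * p u).

Let DN u : D u -> D (- u). Proof. by rewrite -scaleN1r; exact: DZ. Qed.

Let sublinearZ p (t : R) u : sublinear_on p -> 0 <= t -> D u ->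
  p (t *: u) = t * p u.
Proof.
move=> [pD pZ]; rewrite le_eqVlt => /orP[/eqP <- Du|t0 Du].
  rewrite scale0r mul0r.
  have D0 : D 0 by rewrite -(scale0r u); exact: DZ.
  have h : 0 < 2^-1 :> R by rewrite invr_gt0.
  have := pZ _ _ h D0; have := pZ _ _ (@ltr0Sn R 1) D0; rewrite !scaler0; lra.
apply/eqP; rewrite eq_le pZ//=.
have ti : 0 < t^-1 by rewrite invr_gt0.
have := pZ _ _ ti (DZ t Du); rewrite scalerA mulVf ?gt_eqF// scale1r.
by rewrite mulrC ler_pdivlMr// mulrC.
Qed.

Let sublinear0 p u : sublinear_on p -> D u -> p 0 = 0.
Proof.
by move=> hp Du; rewrite -(scale0r u) (sublinearZ hp)// mul0r.
Qed.

Let sublinearN p u : sublinear_on p -> D u -> - p (- u) <= p u.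
Proof.
move=> hp Du; have := hp.1 _ _ Du (DN Du).
by rewrite subrr (sublinear0 hp Du); lra.
Qed.

Lemma le_infD (A B : set R) (c : R) : A !=set0 -> B !=set0 ->
  (forall a b, A a -> B b -> c <= a + b) -> c <= inf A + inf B.
Proof.
move=> A0 B0 h; rewrite -lerBlDl; apply: lb_le_inf => // b Bb.
rewrite lerBlDl -lerBlDr; apply: lb_le_inf => // a Aa.
by rewrite lerBlDr; exact: h.
Qed.

Lemma le_infM (A : set R) (c t : R) : 0 < t -> A !=set0 ->
  (forall a, A a -> c <= t * a) -> c <= t * inf A.
Proof.
move=> t0 A0 h; rewrite -ler_pdivrMl//; apply: lb_le_inf => // a Aa.
by rewrite ler_pdivrMl//; exact: h.
Qed.

(** Fixing the value 0 off [D] makes comparisons off [D] trivial, so the pointwise order on [V] is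
    the order on [D]. *)
Let below (p : V -> R) : Type :=
  {q : V -> R | [/\ sublinear_on q, forall u, D u -> q u <= p u &
    forall u, ~ D u -> q u = 0]}.

(** Zorn's lemma: the pointwise infimum of a chain of sublinear functionals is again sublinear. *)
Let minimal_sublinear p : sublinear_on p -> exists q : below p,
  forall r : below p, (forall u, sval r u <= sval q u) -> r = q.
Proof.
move=> hp.
(* The order is reversed, so that a maximal element is a minimal functional. *)
pose le (q r : below p) := `[< forall u, sval r u <= sval q u >].
have belowE (q r : below p) : sval q = sval r -> q = r.
  by move: q r => [q hq] [r hr] /= e; exact: eq_exist.
suff [q hq] : exists q : below p, forall r, le q r -> r = q.
  by exists q => r hr; apply: hq; exact/asboolP.
apply: Zorn.
- by move=> q; apply/asboolP.
- move=> q r s /asboolP h1 /asboolP h2; apply/asboolP => u.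
  exact: le_trans (h2 u) (h1 u).
- move=> q r /asboolP h1 /asboolP h2; apply: belowE; apply/funext => u.
  by apply/eqP; rewrite eq_le h1 h2.
move=> A totA.
(* The empty chain is bounded by [p] itself, cut off outside [D]. *)
have hp0 : sublinear_on (fun u => if `[< D u >] then p u else 0).
  split => [u v Du Dv|t u t0 Du].
    by rewrite !asboolT//; [exact: hp.1|exact: DD].
  by rewrite !asboolT//; [exact: hp.2|exact: DZ].
have bp : below p.
  exists (fun u => if `[< D u >] then p u else 0); split => //.
    by move=> u Du; rewrite asboolT.
  by move=> u Du; rewrite asboolF.
have [->|/set0P[q0 Aq0]] := eqVneq A set0; first by exists bp.
pose S u := [set sval q u | q in A].
have S0 u : S u !=set0 by exists (sval q0 u); exists q0.
(* A lower bound common to the whole chain, so the infima are genuine. *)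
have Slb u : D u -> lbound (S u) (- p (- u)).
  move=> Du _ [q Aq <-]; have [hq qp _] := svalP q.
  apply: le_trans (sublinearN hq Du); rewrite lerN2; apply: qp; exact: DN.
have infS u q : D u -> A q -> inf (S u) <= sval q u.
  move=> Du Aq; apply: ge_inf; last by exists q.
  by exists (- p (- u)); exact: Slb.
have hq : [/\ sublinear_on (fun u => inf (S u)),
    forall u, D u -> inf (S u) <= p u & forall u, ~ D u -> inf (S u) = 0].
  split; first split.
  - move=> u v Du Dv; apply: le_infD => // _ _ [q Aq <-] [r Ar <-].
    (* Two members of the chain are comparable; the smaller one is used at [u + v]. *)
    have [/asboolP qr|/asboolP rq] := totA _ _ Aq Ar.
      apply: le_trans (infS _ _ (DD Du Dv) Ar) _.
      have [hr _ _] := svalP r.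
      by apply: le_trans (hr.1 _ _ Du Dv) _; rewrite lerD2r.
    apply: le_trans (infS _ _ (DD Du Dv) Aq) _.
    have [hr _ _] := svalP q.
    by apply: le_trans (hr.1 _ _ Du Dv) _; rewrite lerD2l.
  - move=> t u t0 Du; apply: le_infM => // _ [q Aq <-].
    apply: le_trans (infS _ _ (DZ t Du) Aq) _.
    by have [hr _ _] := svalP q; exact: hr.2.
  - move=> u Du; apply: le_trans (infS _ _ Du Aq0) _.
    by have [_ + _] := svalP q0; exact.
  - move=> u Du; suff -> : S u = [set 0] by rewrite inf1.
    apply/seteqP; split => [_ [q Aq <-]|_ ->] /=.
      by have [_ _ ->] := svalP q.
    by exists q0 => //; have [_ _ ->] := svalP q0.
exists (exist _ (fun u => inf (S u)) hq) => q Aq.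
apply/asboolP => u /=; have [Du|Du] := pselect (D u); first exact: infS.
by have [_ _ ->//] := hq; have [_ _ ->] := svalP q.
Qed.

(* A minimal sublinear functional [q] is linear, because for each [x] it is not
   above [v |-> inf_(t >= 0) (q (v + t x) - t q x)], which is sublinear and at
   most [- q x] at [- x]. *)
Theorem Hahn_Banach_sublinear (p : V -> R) : sublinear_on p ->
  exists L : V -> R, [/\ forall u v, D u -> D v -> L (u + v) = L u + L v,
    forall t u, D u -> L (t *: u) = t * L u & forall u, D u -> L u <= p u].
Proof.
move=> hp; have [q qmin] := minimal_sublinear hp.
have [hq qp q0] := svalP q.
have qN x : D x -> sval q (- x) = - sval q x.
  move=> Dx.
  pose S v := [set sval q (v + t *: x) - t * sval q x | t in [set t : R | 0 <= t]].
  pose r v := if `[< D v >] then inf (S v) else 0.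
  have S0 v : S v !=set0 by exists (sval q (v + 0 *: x) - 0 * sval q x); exists 0 => /=.
  have Slb v : D v -> lbound (S v) (- sval q (- v)).
    move=> Dv _ [t t0 <-]; rewrite -(sublinearZ hq t0 Dx).
    have := hq.1 _ _ (DD Dv (DZ t Dx)) (DN Dv).
    by rewrite addrAC subrr add0r; lra.
  have rle v t : D v -> 0 <= t -> r v <= sval q (v + t *: x) - t * sval q x.
    move=> Dv t0; rewrite /r asboolT//; apply: ge_inf; last by exists t.
    by exists (- sval q (- v)); exact: Slb.
  have hr : [/\ sublinear_on r, forall u, D u -> r u <= p u &
      forall u, ~ D u -> r u = 0].
    split; first split.
    - move=> u v Du Dv; rewrite {2}/r {2}/r !asboolT//.
      apply: le_infD => // _ _ [s s0 <-] [t t0 <-].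
      apply: le_trans (rle _ _ (DD Du Dv) (addr_ge0 s0 t0)) _.
      have := hq.1 _ _ (DD Du (DZ s Dx)) (DD Dv (DZ t Dx)).
      by rewrite addrACA -scalerDl; lra.
    - move=> t u t0 Du; rewrite {2}/r asboolT//.
      apply: le_infM => // _ [s s0 <-].
      apply: le_trans (rle _ (t * s) (DZ t Du) (mulr_ge0 (ltW t0) s0)) _.
      rewrite -scalerA -scalerDr (sublinearZ hq (ltW t0)) ?mulrBr ?mulrA//.
      by apply: DD => //; exact: DZ.
    - move=> u Du; apply: le_trans (rle _ _ Du (lexx 0)) _.
      by rewrite scale0r addr0 mul0r subr0; exact: qp.
    - by move=> u Du; rewrite /r asboolF.
  have rq : exist _ r hr = q :> below p.
    apply: qmin => u /=; have [Du|Du] := pselect (D u).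
      by apply: le_trans (rle _ _ Du (lexx 0)) _; rewrite scale0r addr0 mul0r subr0.
    by have [_ _ ->//] := hr; rewrite q0.
  have rE : r = sval q by rewrite -rq.
  have := rle _ _ (DN Dx) ler01; rewrite rE scale1r addNr mul1r.
  rewrite (sublinear0 hq Dx) => h1; have := sublinearN hq Dx; lra.
exists (sval q); split => //.
- move=> u v Du Dv; apply/eqP; rewrite eq_le hq.1//=.
  have := hq.1 _ _ (DN Du) (DN Dv); rewrite -opprD !qN//; last exact: DD.
  lra.
- move=> t u Du; have [t0|t0] := leP 0 t; first exact: sublinearZ.
  rewrite -[t]opprK scaleNr qN; last by apply: DZ.
  by rewrite (sublinearZ hq)// ?mulNr// oppr_ge0 ltW.
Qed.

End HahnBanach.

Definition linear_on (R : realType) (V : lmodType R) (D : set V) (L : V -> R) : Prop :=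
  (forall u v, D u -> D v -> L (u + v) = L u + L v) /\
  (forall t u, D u -> L (t *: u) = t * L u).

Definition monotone_on (R : realType) (T : Type) (D : set (T -> R))
    (M : (T -> R) -> R) : Prop :=
  forall f g, D f -> D g -> (forall x, f x <= g x) -> M f <= M g.

Lemma linear_on0 (R : realType) (V : lmodType R) (D : set V) (L : V -> R) :
  D 0 -> linear_on D L -> L 0 = 0.
Proof. by move=> D0 [_ LZ]; rewrite -(scale0r 0) LZ// mul0r. Qed.

Lemma linear_onB (R : realType) (V : lmodType R) (D : set V) (L : V -> R) :
  (forall t u, D u -> D (t *: u)) -> linear_on D L ->
  forall u v, D u -> D v -> L (u - v) = L u - L v.
Proof.
move=> DZ [LD LZ] u v Du Dv; rewrite -scaleN1r LD//; last exact: DZ.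
by rewrite LZ// mulN1r.
Qed.

(** * Splitting a positive functional along a sum it dominates *)

Section Splitting.
Variables (R : realType) (T : Type) (D G : set (T -> R)).
Hypothesis DD : forall f g, D f -> D g -> D (f + g).
Hypothesis DZ : forall (t : R) f, D f -> D (t *: f).
Hypothesis Dmax : forall f g, D f -> D g -> D (fun x => Num.max (f x) (g x)).
Hypothesis GsubD : G `<=` D.
Hypothesis G0 : G 0.
Hypothesis GD : forall f g, G f -> G g -> G (f + g).
Hypothesis GZ : forall (t : R) f, 0 < t -> G f -> G (t *: f).
Hypothesis Gmax : forall f g, G f -> G g -> G (fun x => Num.max (f x) (g x)).
Variables (N M1 M2 : (T -> R) -> R).
Hypotheses (linN : linear_on D N) (lin1 : linear_on D M1) (lin2 : linear_on D M2).
Hypotheses (monN : monotone_on D N) (mon1 : monotone_on D M1)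
  (mon2 : monotone_on D M2).
Hypothesis domN : forall g, G g -> M1 g + M2 g <= N g.

Let D0 : D 0. Proof. exact: GsubD. Qed.

Let DB f g : D f -> D g -> D (f - g).
Proof. by move=> Df Dg; apply: DD => //; rewrite -scaleN1r; exact: DZ. Qed.

Let pos (f : T -> R) : T -> R := fun x => Num.max (f x) 0.

Let Dpos f : D f -> D (pos f). Proof. by move=> Df; exact: Dmax. Qed.

(** The functional [L] sought must satisfy [L u <= N (pos u)], [L (- g) <= - M1 g] and
    [L h <= N h - M2 h]. Adding these along [f = (f + g - h) + (- g) + h] bounds [L f] by
    [cost f g h], so [inf (costs f)] is the natural sublinear bound. *)
Let cost (f g h : T -> R) := N (pos (f + g - h)) - M1 g + N h - M2 h.

Let costs f := [set cost f gh.1 gh.2 | gh in [set gh | G gh.1 /\ G gh.2]].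

Let Dpos3 f g h : D f -> G g -> G h -> D (pos (f + g - h)).
Proof. by move=> *; apply: Dpos; apply: DB; [apply: DD => //|]; exact: GsubD. Qed.

Let costs0 f : costs f !=set0.
Proof. by exists (cost f 0 0); exists (0, 0). Qed.

(* [max g h = (g - h)^+ + h] is in [G], which bounds the cost of [f = 0] below
   by [M1 (max g h - g) + M2 (max g h - h)]. *)
Let cost_ge f g h : D f -> G g -> G h -> - N (pos (- f)) <= cost f g h.
Proof.
move=> Df Gg Gh; pose m := fun x => Num.max (g x) (h x).
have Gm : G m by exact: Gmax.
have DNf : D (- f) by rewrite -scaleN1r; exact: DZ.
have h1 : N m <= N (pos (f + g - h) + pos (- f) + h).
  apply: monN; first exact: GsubD.
    apply: DD; last exact: GsubD.
    by apply: DD; [exact: Dpos3|exact: Dpos].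
  move=> x; rewrite /m /pos !fctE ge_max; apply/andP; split.
    have : f x + g x - h x <= Num.max (f x + g x - h x) 0 by rewrite le_max lexx.
    have : - f x <= Num.max (- f x) 0 by rewrite le_max lexx.
    lra.
  have : 0 <= Num.max (f x + g x - h x) 0 by rewrite le_max lexx orbT.
  have : 0 <= Num.max (- f x) 0 by rewrite le_max lexx orbT.
  lra.
have h2 := domN Gm.
have h3 : M1 g <= M1 m.
  by apply: mon1 => [||x]; [exact: GsubD..|rewrite /m le_max lexx].
have h4 : M2 h <= M2 m.
  by apply: mon2 => [||x]; [exact: GsubD..|rewrite /m le_max lexx orbT].
have Dp := Dpos3 Df Gg Gh.
have Dn : D (pos (- f)) by exact: Dpos.
move: h1; rewrite linN.1 ?linN.1 //; [|exact: DD|exact: GsubD].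
rewrite /cost; lra.
Qed.

Let inf_costs_le f g h : D f -> G g -> G h -> inf (costs f) <= cost f g h.
Proof.
move=> Df Gg Gh; apply: ge_inf; last by exists (g, h).
by exists (- N (pos (- f))) => _ [[g' h'] [/= Gg' Gh'] <-]; exact: cost_ge.
Qed.

(** The triples for [f] and [f'] add up to a triple for [f + f'], because [G] is a convex cone;
    [pos] is subadditive and positively homogeneous. *)
Let sublinear_costs : sublinear_on D (fun f => inf (costs f)).
Proof.
split => [f f' Df Df'|t f t0 Df].
  apply: le_infD => // _ _ [[g h] [/= Gg Gh] <-] [[g' h'] [/= Gg' Gh'] <-].
  apply: le_trans (inf_costs_le (DD Df Df') (GD Gg Gg') (GD Gh Gh')) _.
  rewrite /cost lin1.1 ?lin2.1 ?linN.1; try exact: GsubD.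
  have Dp := Dpos3 Df Gg Gh; have Dp' := Dpos3 Df' Gg' Gh'.
  suff : N (pos (f + f' + (g + g') - (h + h'))) <=
         N (pos (f + g - h) + pos (f' + g' - h')) by rewrite linN.1//; lra.
  apply: monN; [|exact: DD|].
    by apply: Dpos3; [exact: DD|exact: GD..].
  move=> x; rewrite /pos !fctE ge_max; apply/andP; split.
    have : f x + g x - h x <= Num.max (f x + g x - h x) 0 by rewrite le_max lexx.
    have : f' x + g' x - h' x <= Num.max (f' x + g' x - h' x) 0.
      by rewrite le_max lexx.
    lra.
  by rewrite addr_ge0// le_max lexx orbT.
apply: le_infM => // _ [[g h] [/= Gg Gh] <-].
apply: le_trans (inf_costs_le (DZ t Df) (GZ t0 Gg) (GZ t0 Gh)) _.
rewrite /cost lin1.2 ?lin2.2 ?linN.2; try exact: GsubD.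
have Dp := Dpos3 Df Gg Gh.
have -> : pos (t *: f + t *: g - t *: h) = t *: pos (f + g - h).
  apply/funext => x.
  have e : t * Num.max (f x + g x - h x) 0 =
      Num.max (t * f x + t * g x - t * h x) 0.
    by rewrite maxr_pMr ?(ltW t0)// mulr0 mulrBr mulrDr.
  exact: esym e.
rewrite linN.2//; lra.
Qed.

(** Hahn-Banach below [inf (costs f)]. The properties are read off from single costs: [(- f, 0, 0)]
    gives positivity, [(f, 0, 0)] domination by [N], [(- g, g, 0)] the bound for [M1] and
    [(g, 0, g)] the one for [M2]. *)
Lemma split_functional : exists L : (T -> R) -> R,
  [/\ linear_on D L,
      forall f, D f -> (forall x, 0 <= f x) -> 0 <= L f <= N f,
      forall g, G g -> M1 g <= L g &
      forall g, G g -> M2 g <= N g - L g].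
Proof.
have [L [LD LZ Lp]] := Hahn_Banach_sublinear DD DZ sublinear_costs.
have N0 : N 0 = 0 by exact: linear_on0 linN.
have M10 : M1 0 = 0 by exact: linear_on0 lin1.
have M20 : M2 0 = 0 by exact: linear_on0 lin2.
have pos0 : pos 0 = 0 by apply/funext => x; rewrite /pos maxxx.
have LN f : D f -> L (- f) = - L f by move=> Df; rewrite -scaleN1r LZ// mulN1r.
have DN f : D f -> D (- f) by move=> Df; rewrite -scaleN1r; exact: DZ.
exists L; split => //.
- move=> f Df f0; apply/andP; split.
    have := le_trans (Lp _ (DN _ Df)) (inf_costs_le (DN _ Df) G0 G0).
    rewrite /cost N0 M10 M20 LN// addr0 subr0 subr0 subr0 addr0.
    suff -> : pos (- f) = 0 by rewrite N0 oppr_le0.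
    by apply/funext => x; rewrite /pos; apply/max_r; rewrite oppr_le0.
  have := le_trans (Lp _ Df) (inf_costs_le Df G0 G0).
  rewrite /cost N0 M10 M20 addr0 subr0 subr0 subr0 addr0.
  suff -> : pos f = f by [].
  by apply/funext => x; rewrite /pos; apply/max_l.
- move=> g Gg; have Dg := GsubD Gg.
  have := le_trans (Lp _ (DN _ Dg)) (inf_costs_le (DN _ Dg) Gg G0).
  by rewrite /cost N0 M20 LN// addNr !subr0 pos0 N0; lra.
- move=> g Gg; have Dg := GsubD Gg.
  have := le_trans (Lp _ Dg) (inf_costs_le Dg G0 Gg).
  by rewrite /cost M10 addr0 subrr pos0 N0 subr0; lra.
Qed.

End Splitting.

(** * Functionals on bounded measurable functions *)

Section BoundedMeasurable.
Context d (T : measurableType d) (R : realType).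
Implicit Types (f g : T -> R) (A : set T) (P : probability T R).

(** This space contains the indicators, so a functional on it yields a set function at once, with no
    Riesz representation. *)
Definition bounded_measurable : set (T -> R) :=
  [set f : T -> R | measurable_fun setT f /\ exists M : R, forall x, `|f x| <= M].

Local Notation D := bounded_measurable.

Lemma bounded_measurable_cst (r : R) : D (cst r).
Proof. by split; [exact: measurable_cst|exists `|r|]. Qed.

Lemma bounded_measurableD f g : D f -> D g -> D (f + g).
Proof.
move=> [mf [M hM]] [mg [N hN]]; split; first exact: measurable_funD.
exists (M + N) => x; exact: le_trans (ler_normD _ _) (lerD (hM x) (hN x)).
Qed.

Lemma bounded_measurableM f g : D f -> D g -> D (f * g).
Proof.
move=> [mf [M hM]] [mg [N hN]]; split; first exact: measurable_funM.
by exists (M * N) => x; rewrite normrM ler_pM.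
Qed.

Lemma bounded_measurableZ (t : R) f : D f -> D (t *: f).
Proof. by move=> Df; exact: (bounded_measurableM (bounded_measurable_cst t)). Qed.

Lemma bounded_measurableB f g : D f -> D g -> D (f - g).
Proof.
move=> Df Dg; apply: bounded_measurableD => //.
by rewrite -scaleN1r; exact: bounded_measurableZ.
Qed.

Lemma bounded_measurable_max f g : D f -> D g -> D (fun x => Num.max (f x) (g x)).
Proof.
move=> [mf [M hM]] [mg [N hN]]; split; first exact: measurable_maxr.
exists (Num.max M N) => x; rewrite le_max.
by case: (leP (f x) (g x)) => _; rewrite ?hM ?hN ?orbT.
Qed.

Lemma bounded_measurable_indic A : measurable A -> D \1_A.
Proof.
move=> mA; split; first exact: measurable_indic.
by exists 1 => x; rewrite indicE; case: (x \in A); rewrite ?normr1 ?normr0 ?ler01.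
Qed.

Lemma bounded_measurable_sum (I : Type) (s : seq I) (F : I -> T -> R) :
  (forall i, D (F i)) -> D (\sum_(i <- s) F i).
Proof.
move=> DF; elim/big_ind : _ => //; first exact: (bounded_measurable_cst 0).
exact: bounded_measurableD.
Qed.

Lemma linear_on_sum (L : (T -> R) -> R) (I : Type) (s : seq I) (F : I -> T -> R) :
  linear_on D L -> (forall i, D (F i)) ->
  L (\sum_(i <- s) F i) = \sum_(i <- s) L (F i).
Proof.
move=> linL DF; elim: s => [|i s IH].
  by rewrite !big_nil (linear_on0 _ linL)//; exact: (bounded_measurable_cst 0).
by rewrite !big_cons linL.1 ?IH//; exact: bounded_measurable_sum.
Qed.

Lemma positive_monotone (L : (T -> R) -> R) : linear_on D L ->
  (forall f, D f -> (forall x, 0 <= f x) -> 0 <= L f) -> monotone_on D L.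
Proof.
move=> linL pos f g Df Dg fg; rewrite -subr_ge0.
rewrite -(linear_onB bounded_measurableZ linL)//; apply: pos => [|x].
  exact: bounded_measurableB.
by rewrite subr_ge0.
Qed.

(** The sum counts the levels [e], [2e], ... up to [y], so [e] times it is [y] rounded down to a
    multiple of [e]. *)
Lemma layer_approx (e y : R) (N : nat) : 0 < e -> 0 <= y -> y <= e * N%:R ->
  e * (\sum_(k < N) (e * k.+1%:R <= y)%R%:R) <= y <=
  e * (\sum_(k < N) (e * k.+1%:R <= y)%R%:R) + e.
Proof.
move=> e0 y0 yN; set S := fun n => \sum_(k < n) ((e * k.+1%:R <= y)%R%:R : R).
have SS n : S n.+1 = S n + (e * n.+1%:R <= y)%R%:R by rewrite /S big_ord_recr.
(* The first half, all [n] levels being counted when [y] reaches the last one, carries the induction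
   past level [n]. *)
suff H n : (e * n%:R <= y -> e * S n = e * n%:R) /\
           (y <= e * n%:R -> e * S n <= y <= e * S n + e) by exact: (H N).2.
elim: n => [|n [IH1 IH2]].
  rewrite /S big_ord0 mulr0; split=> // y0'.
  by rewrite y0 add0r (le_trans y0')// ltW.
rewrite SS; have eS : e * n.+1%:R = e * n%:R + e by rewrite -natr1 mulrDr mulr1.
case: (leP (e * n.+1%:R) y) => hy; rewrite ?addr0.
  have h1 : e * n%:R <= y by move: hy; rewrite eS; lra.
  have h2 := IH1 h1.
  by split => [_|h3]; rewrite mulrDr mulr1 h2 -eS//; lra.
split => [//|_].
have [h1|h1] := leP (e * n%:R) y; last exact/IH2/ltW.
by rewrite (IH1 h1); move: hy; rewrite eS; lra.
Qed.

(** A bounded measurable function is a uniform limit of combinations of indicators of its superlevel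
    sets, and monotonicity turns uniform closeness into closeness of values. *)
Lemma linear_on_eq_indic (L L' : (T -> R) -> R) :
  linear_on D L -> linear_on D L' -> monotone_on D L -> monotone_on D L' ->
  (forall A, measurable A -> L \1_A = L' \1_A) -> forall f, D f -> L f = L' f.
Proof.
move=> lL lL' mL mL' e f Df.
have D1 : D (cst 1) by exact: bounded_measurable_cst.
have e1 : L (cst 1) = L' (cst 1).
  by have := e setT measurableT; rewrite indicT.
(* Adding the bound [M] makes [f] nonnegative, and the two functionals agree on constants. *)
wlog f0 : f Df / forall x, 0 <= f x.
  move=> H; have [_ [M hM]] := Df.
  have DM : D (M *: cst 1) by exact: bounded_measurableZ.
  have := H (f + M *: cst 1) (bounded_measurableD Df DM) _.
  rewrite lL.1// lL'.1// lL.2// lL'.2// e1 => h; apply: (addIr (M * L' (cst 1))).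
  apply: h => x; have := hM x; rewrite ler_norml => /andP[+ _].
  by move=> h1; change (0 <= f x + M * 1); lra.
suff H (L1 L2 : (T -> R) -> R) : linear_on D L1 -> linear_on D L2 ->
    monotone_on D L1 -> monotone_on D L2 ->
    (forall A, measurable A -> L1 \1_A = L2 \1_A) ->
    L1 (cst 1) = L2 (cst 1) -> L1 f <= L2 f.
  by apply/eqP; rewrite eq_le !H// => A mA; rewrite e.
move=> {lL lL' mL mL' e e1} lL lL' mL mL' e e1; have [mf [M hM]] := Df.
suff H (eps : R) : 0 < eps -> L1 f <= L2 f + eps * L2 (cst 1).
  have c0 : 0 <= L2 (cst 1).
    rewrite -(linear_on0 (bounded_measurable_cst 0) lL'); apply: mL' => //.
    exact: (bounded_measurable_cst 0).
  apply/ler_addgt0Pl => r r0; rewrite addrC.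
  (* The [+ 1] covers the case [L2 (cst 1) = 0]. *)
  have r1 : 0 < r / (L2 (cst 1) + 1) by rewrite divr_gt0// ltr_wpDl.
  apply: le_trans (H _ r1) _; rewrite lerD2l mulrAC ler_pdivrMr ?ltr_wpDl//.
  by rewrite ler_pM2l// lerDl.
move=> e0; have [N] : exists N : nat, M / eps <= N%:R.
  by exists (Num.truncn (M / eps)).+1; exact/ltW/truncnS_gt.
rewrite ler_pdivrMr// mulrC => MN.
pose A (k : 'I_N) := [set x | eps * k.+1%:R <= f x].
have mA k : measurable (A k).
  rewrite (_ : A k = setT `&` f @^-1` `[eps * k.+1%:R, +oo[%classic).
    exact: mf.
  by rewrite setTI; apply/seteqP; split => x /=; rewrite in_itv/= andbT.
have DA k : D \1_(A k) by exact: bounded_measurable_indic.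
pose s := eps *: \sum_(k < N) (\1_(A k) : T -> R).
have sE x : s x = eps * (\sum_(k < N) (eps * k.+1%:R <= f x)%R%:R).
  change (eps * (\sum_(k < N) (\1_(A k) : T -> R)) x =
    eps * (\sum_(k < N) (eps * k.+1%:R <= f x)%R%:R)); rewrite fct_sumE.
  congr (_ * _); apply: eq_bigr => k _; rewrite indicE; congr (nat_of_bool _)%:R.
  by apply/idP/idP; rewrite inE.
have Ds : D s by apply: bounded_measurableZ; exact: bounded_measurable_sum.
have sf x : s x <= f x <= s x + eps.
  rewrite sE; apply: layer_approx => //; apply: le_trans MN.
  exact: le_trans (ler_norm _) (hM x).
have Ls : L1 s = L2 s.
  rewrite lL.2 ?lL'.2; try exact: bounded_measurable_sum.
  rewrite !linear_on_sum//; congr (_ * _).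
  by apply: eq_bigr => k _; exact: e.
have De : D (eps *: cst 1) by exact: bounded_measurableZ.
have h1 : L1 f <= L1 (s + eps *: cst 1).
  apply: mL => // [|x]; first exact: bounded_measurableD.
  by change (f x <= s x + eps * 1); rewrite mulr1; have /andP[] := sf x.
have h2 : L2 s <= L2 f by apply: mL' => // x; have /andP[] := sf x.
by apply: le_trans h1 _; rewrite lL.1// Ls (lL.2 eps (cst 1))// e1 lerD2r.
Qed.

Definition expect P f : R := \int[P]_x f x.

Lemma bounded_measurable_integrable P f : D f -> P.-integrable setT (EFin \o f).
Proof.
move=> [mf [M hM]]; apply: measurable_bounded_integrable => //.
  by rewrite ltey_eq fin_num_measure.
exists M; split; first by rewrite num_real.
by move=> x Mx y _ /=; exact: le_trans (hM y) (ltW Mx).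
Qed.

Lemma expect_linear P : linear_on D (expect P).
Proof.
split=> [f g Df Dg|t f Df].
  by apply: RintegralD => //; exact: bounded_measurable_integrable.
by apply: RintegralZl => //; exact: bounded_measurable_integrable.
Qed.

Lemma expect_monotone P : monotone_on D (expect P).
Proof.
move=> f g Df Dg fg; apply: le_Rintegral => //; exact: bounded_measurable_integrable.
Qed.

Lemma expect_indic P A : measurable A -> expect P \1_A = fine (P A).
Proof. by move=> mA; rewrite /expect /Rintegral integral_indic// setIT. Qed.

Lemma expect_cst P (r : R) : expect P (cst r) = r.
Proof.
rewrite /expect Rintegral_cst// (_ : fine _ = 1) ?mulr1//.
by rewrite -[RHS]/(fine 1%E); congr fine; exact: probability_setT.
Qed.

Lemma EFin_expect P f : D f -> (\int[P]_x (f x)%:E = (expect P f)%:E)%E.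
Proof.
move=> Df; rewrite /expect /Rintegral fineK//; apply: integrable_fin_num => //.
exact: bounded_measurable_integrable.
Qed.

Lemma fine_probE P A : measurable A -> P A = (fine (P A))%:E.
Proof. by move=> mA; rewrite fineK// fin_num_measure. Qed.

Lemma EFin_expect_indic P A : measurable A -> P A = (expect P \1_A)%:E.
Proof. by move=> mA; rewrite expect_indic// fine_probE. Qed.

(* Domination by [P] makes the finitely additive set function [L \1_A]
   continuous at the empty set. *)
Lemma functional_probability P (L : (T -> R) -> R) (c : R) :
  linear_on D L ->
  (forall f, D f -> (forall x, 0 <= f x) -> 0 <= L f <= c * expect P f) ->
  L (cst 1) = 1 ->
  exists Q : probability T R, forall f, D f -> expect Q f = L f.
Proof.
move=> lL dom L1.
have posL f : D f -> (forall x, 0 <= f x) -> 0 <= L f.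
  by move=> Df f0; have /andP[] := dom f Df f0.
have Lindic A : measurable A -> 0 <= L \1_A.
  by move=> mA; apply: posL => //; exact: bounded_measurable_indic.
(* On a nonmeasurable [A] the sign of [L \1_A] is unknown; the absolute value makes [m] nonnegative
   on every set. *)
pose m A : \bar R := `|L \1_A|%:E.
have mE A : measurable A -> m A = (L \1_A)%:E.
  by move=> mA; rewrite /m ger0_norm// Lindic.
have m0 : m set0 = 0%E.
  rewrite mE// indic0 (linear_on0 _ lL)//; exact: (bounded_measurable_cst 0).
have mge0 A : (0 <= m A)%E by rewrite lee_fin.
have msigma : semi_sigma_additive m.
  move=> F mF tF mUF.
  have DU := bounded_measurable_indic mUF.
  have DF i := bounded_measurable_indic (mF i).
  (* By disjointness [tail n] is the indicator of the union of the [F i] with [i >= n]. Its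
     expectation tends to 0, and domination squeezes [L (tail n)] to 0. *)
  pose tail n := \1_(\bigcup_k F k) - \sum_(0 <= i < n) (\1_(F i) : T -> R).
  have Dtail n : D (tail n).
    by apply: bounded_measurableB => //; exact: bounded_measurable_sum.
  have tail0 n x : 0 <= tail n x.
    change (0 <= \1_(\bigcup_k F k) x -
      (\sum_(0 <= i < n) (\1_(F i) : T -> R)) x); rewrite subr_ge0.
    have e : (\sum_(0 <= i < n) (\1_(F i) : T -> R)) x =
        \1_(\big[setU/set0]_(i < n) F i) x.
      rewrite big_mkord fct_sumE.
      elim: n => [|n IH]; first by rewrite !big_ord0 indic0.
      rewrite !big_ord_recr/= IH !indicE in_setU.
      have : ~ ((\big[setU/set0]_(i < n) F i) x /\ F n x).
        move=> [hx Fx]; move: hx; rewrite -bigcup_mkord => -[k /= kn Fk].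
        have := tF k n Logic.I Logic.I (ex_intro _ x (conj Fk Fx)).
        by move=> kn'; rewrite kn' ltnn in kn.
      case: (asboolP ((\big[setU/set0]_(i < n) F i) x)) => h1;
      case: (asboolP (F n x)) => h2 h3.
      - by exfalso; exact: h3.
      - by rewrite mem_set// memNset// addr0.
      - by rewrite memNset// mem_set// add0r.
      - by rewrite !memNset// addr0.
    rewrite e !indicE ler_nat -bigcup_mkord.
    case: (boolP (x \in \bigcup_(i < n) F i)) => //; rewrite inE => -[k _ Fk].
    by rewrite mem_set//; exists k.
  have tailL n : L (tail n) = L \1_(\bigcup_k F k) - \sum_(0 <= i < n) L \1_(F i).
    rewrite (linear_onB bounded_measurableZ lL)//; last exact: bounded_measurable_sum.
    by rewrite linear_on_sum.
  have tailE n : expect P (tail n) =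
      fine (P (\bigcup_k F k)) - \sum_(0 <= i < n) fine (P (F i)).
    rewrite (linear_onB bounded_measurableZ (expect_linear P))//; last first.
      exact: bounded_measurable_sum.
    rewrite (linear_on_sum _ (expect_linear P))// expect_indic//; congr (_ - _).
    by apply: eq_bigr => i _; rewrite expect_indic.
  have cP : expect P (tail n) @[n --> \oo] --> (0 : R).
    have : (\sum_(0 <= i < n) P (F i))%E @[n --> \oo] -->
        (fine (P (\bigcup_k F k)))%:E.
      by rewrite -fine_probE//; exact: measure_semi_sigma_additive.
    move=> /fine_cvgP[_ cv].
    have -> : 0 = fine (P (\bigcup_k F k)) - fine (P (\bigcup_k F k)).
      by rewrite subrr.
    under eq_fun do rewrite tailE.
    apply: cvgB; first exact: cvg_cst.
    move: cv; rewrite (_ : _ \o _ = fun n => \sum_(0 <= i < n) fine (P (F i)))//.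
    apply/funext => n /=.
    rewrite (eq_bigr (fun i => (fine (P (F i)))%:E)) ?sumEFin// => i _.
    exact: fine_probE.
  have cL : L (tail n) @[n --> \oo] --> (0 : R).
    have cP0 : c * expect P (tail n) @[n --> \oo] --> (0 : R).
      by rewrite -(mulr0 c); apply: cvgMr.
    apply: (squeeze_cvgr _ (cvg_cst 0) cP0).
    by apply: nearW => n; exact: dom.
  rewrite mE//.
  have -> : (fun n => \sum_(0 <= i < n) m (F i))%E =
      (fun n => (L \1_(\bigcup_k F k) - L (tail n))%:E).
    apply/funext => n; rewrite tailL opprB addrC subrK -sumEFin.
    by apply: eq_bigr => i _; exact: mE.
  apply: cvg_EFin; first exact: nearW.
  rewrite /comp /= -[X in _ --> X]subr0.
  by apply: cvgB => //; exact: cvg_cst.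
have [mm mmE] : exists mm : {measure set T -> \bar R}, forall A, mm A = m A.
  pose mm : {measure set T -> \bar R} :=
    HB.pack m (isMeasure.Build _ _ _ m m0 mge0 msigma).
  by exists mm.
have mT : mm setT = 1%E by rewrite mmE mE// indicT -[X in L X]/(cst 1) L1.
(* The total mass is already 1, so normalising changes nothing; [P] is only the default for
   degenerate masses. *)
pose Q : probability T R := mnormalize mm P.
have QE A : Q A = m A.
  by rewrite -mmE /Q /= /mnormalize /= mT onee_eq0/= invr1 mule1.
exists Q; apply: linear_on_eq_indic => //.
- exact: expect_linear.
- exact: expect_monotone.
- exact: positive_monotone.
by move=> A mA; rewrite expect_indic// QE mE.
Qed.

End BoundedMeasurable.

(** * Convex order through bounded Borel functions *)

Section ConvexOrder.
Variables (R : realType) (n : nat) (K : set 'rV[R]_n).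
Local Notation T := (borelRn R n).
Local Notation D := (@bounded_measurable _ T R).

Lemma open_borel (U : set T) : open (U : set 'rV[R]_n) -> measurable U.
Proof. exact: sub_sigma_algebra. Qed.

Lemma closed_borel (F : set T) : closed (F : set 'rV[R]_n) -> measurable F.
Proof.
move=> cF; rewrite -(setCK F); apply: measurableC; apply: open_borel.
exact: closed_openC.
Qed.

Lemma set1_borel (x : T) : measurable [set x].
Proof.
apply: closed_borel; apply/accessible_closed_set1/hausdorff_accessible.
exact: norm_hausdorff.
Qed.

Lemma compact_closed_rV : compact K -> closed K.
Proof. by apply: compact_closed; exact: norm_hausdorff. Qed.

Lemma compact_borel : compact K -> measurable (K : set T).
Proof. by move=> cK; apply: closed_borel; exact: compact_closed_rV. Qed.

Lemma within_continuous_bounded_measurable (f : 'rV[R]_n -> R) :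
  compact K -> {within K, continuous f} -> D (f \_ K).
Proof.
move=> cK cf; split.
  apply/(measurable_restrictT (f : T -> R)); first exact: compact_borel.
  move=> _; apply: (measurability _ (RGenOpens.measurableE R)).
  move=> _ [_ [a [b ->] <-]].
  have /open_subspaceP[V oV VK] := (continuousP _).1 cf _
    (@interval_open R (BRight a) (BLeft b) isT isT).
  rewrite setIC -VK; apply: measurableI; first exact: open_borel.
  exact: compact_borel.
  exact: compact_borel.
have /compact_bounded[M [_ hM]] := continuous_compact cf cK.
exists (`|M| + 1) => x; rewrite /patch; case: ifPn => [|_]; last first.
  by rewrite normr0 addr_ge0.
rewrite inE => Kx; apply: (hM (`|M| + 1)); last by exists x.
by rewrite (le_lt_trans (ler_norm M))// ltrDl.
Qed.

Lemma convex_functionP (f : 'rV[R]_n -> R) : convex_function K f <->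
  forall x y (t : R), K x -> K y -> 0 <= t -> t <= 1 ->
    f (t *: x + (1 - t) *: y) <= t * f x + (1 - t) * f y.
Proof.
split=> [cf x y t Kx Ky t0 t1|cf t x y].
  by have := cf (Itv01 t0 t1) x y (mem_set Kx) (mem_set Ky).
by rewrite !inE => Kx Ky; apply: cf.
Qed.

Lemma convex_setP : convex_set K <->
  forall x y (t : R), K x -> K y -> 0 <= t -> t <= 1 ->
    K (t *: x + (1 - t) *: y).
Proof.
split=> [cK x y t Kx Ky t0 t1|cK x y t].
  by have := cK x y (Itv01 t0 t1) (mem_set Kx) (mem_set Ky); rewrite inE.
by rewrite !inE => Kx Ky; apply: cK.
Qed.

(** Extension by 0 turns integrals over [K] into expectations of functions on the whole space;
    convexity and continuity are asked on [K] only. *)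
Definition convex_continuous : set (T -> R) :=
  [set g | exists f : 'rV[R]_n -> R,
    [/\ {within K, continuous f}, convex_function K f & g = f \_ K]].

Local Notation G := convex_continuous.

Lemma convex_continuous_bounded_measurable : compact K -> G `<=` D.
Proof.
by move=> cK _ [f [cf _ ->]]; exact: within_continuous_bounded_measurable.
Qed.

Lemma convex_continuousD f g : G f -> G g -> G (f + g).
Proof.
move=> [f' [cf vf ->]] [g' [cg vg ->]]; exists (f' + g'); split.
- by move=> x; apply: cvgD; [exact: cf|exact: cg].
- apply/convex_functionP => x y t Kx Ky t0 t1.
  have := (convex_functionP f').1 vf x y t Kx Ky t0 t1.
  have := (convex_functionP g').1 vg x y t Kx Ky t0 t1.
  by rewrite !fctE; lra.
- by apply/funext => x; rewrite !fctE /patch; case: ifP => _ //; rewrite addr0.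
Qed.

Lemma convex_continuousZ (t : R) f : 0 < t -> G f -> G (t *: f).
Proof.
move=> t0 [f' [cf vf ->]]; exists (t *: f'); split.
- by move=> x; apply: cvgZr; exact: cf.
- apply/convex_functionP => x y s Kx Ky s0 s1.
  have h := (convex_functionP f').1 vf x y s Kx Ky s0 s1.
  change (t * f' (s *: x + (1 - s) *: y) <=
          s * (t * f' x) + (1 - s) * (t * f' y)).
  have := ler_wpM2l (ltW t0) h; lra.
- apply/funext => x; rewrite /patch.
  change (t * (if x \in K then f' x else 0) = if x \in K then t * f' x else 0).
  by case: ifP => _ //; rewrite mulr0.
Qed.

Lemma convex_continuous_max f g : G f -> G g -> G (fun x => Num.max (f x) (g x)).
Proof.
move=> [f' [cf vf ->]] [g' [cg vg ->]]; exists (fun x => Num.max (f' x) (g' x)); split.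
- by move=> x; apply: continuous_max; [exact: cf|exact: cg].
- apply/convex_functionP => x y t Kx Ky t0 t1.
  have hf := (convex_functionP f').1 vf x y t Kx Ky t0 t1.
  have hg := (convex_functionP g').1 vg x y t Kx Ky t0 t1.
  have t1' : 0 <= 1 - t by rewrite subr_ge0.
  rewrite ge_max; apply/andP; split.
    by apply: le_trans hf _; apply: lerD; apply: ler_wpM2l => //; rewrite le_max lexx.
  by apply: le_trans hg _; apply: lerD; apply: ler_wpM2l => //; rewrite le_max lexx orbT.
- by apply/funext => x; rewrite /patch; case: ifP => _ //; rewrite maxxx.
Qed.

Lemma convex_continuous_affine (f : 'rV[R]_n -> R) : continuous f ->
  (forall x y (t : R), f (t *: x + (1 - t) *: y) = t * f x + (1 - t) * f y) ->
  G (f \_ K).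
Proof.
move=> cf af; exists f; split => //; first exact: continuous_subspaceT.
by apply/convex_functionP => x y t _ _ _ _; rewrite af.
Qed.

Lemma convex_continuous_cst (r : R) : G (cst r \_ K).
Proof.
apply: convex_continuous_affine => [|x y t]; first exact: cst_continuous.
by rewrite /cst; ring.
Qed.

Lemma convex_continuous0 : G 0.
Proof.
suff -> : (0 : T -> R) = cst 0 \_ K by exact: convex_continuous_cst.
by apply/funext => x; rewrite /patch; case: ifP.
Qed.

(** Cut off outside [K] because a coordinate is unbounded on the whole space. *)
Definition coord (k : 'I_n) : T -> R := (fun y : 'rV[R]_n => y ord0 k) \_ K.

Lemma convex_continuous_coord k : G (coord k).
Proof.
apply: convex_continuous_affine => [|x y t]; first exact: coord_continuous.
by rewrite !mxE.
Qed.

Lemma convex_continuous_coordN k : G (- coord k).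
Proof.
suff -> : - coord k = (fun y : 'rV[R]_n => - y ord0 k) \_ K.
  apply: convex_continuous_affine => [x|x y t].
    exact: (cvgN (@coord_continuous R 1 n ord0 k x)).
  by rewrite !mxE; ring.
apply/funext => x; change (- (if x \in K then x ord0 k else 0) =
  if x \in K then - x ord0 k else 0).
by case: ifP => _ //; rewrite oppr0.
Qed.

Lemma indic_restrict : (\1_K : T -> R) = cst (1 : R) \_ K.
Proof. by apply/funext => x; rewrite indicE /patch; case: (x \in K). Qed.

Lemma prob_expect1 (P : borel_prob R n) (A : set T) : measurable A ->
  P A = 1%E <-> expect P \1_A = 1.
Proof.
move=> mA; rewrite expect_indic//; split=> [->//|e].
by rewrite fine_probE// e.
Qed.

(** Continuous functions on the compact [K] are bounded, so both integrals are finite and their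
    extended difference is one of real numbers. *)
Lemma convex_order_pairsP (p : borel_prob R n * borel_prob R n) : compact K ->
  convex_order_pairs K p <->
  [/\ p.1 K = 1%E, p.2 K = 1%E & forall g, G g -> expect p.1 g <= expect p.2 g].
Proof.
move=> cK.
have h (f : 'rV[R]_n -> R) : {within K, continuous f} ->
    (\int[p.1]_(x in (K : set T)) (f x)%:E
       - \int[p.2]_(x in (K : set T)) (f x)%:E <= 0)%E =
    (expect p.1 (f \_ K) <= expect p.2 (f \_ K)).
  move=> cf; have Df := within_continuous_bounded_measurable cK cf.
  have e (P : borel_prob R n) :
      (\int[P]_(x in (K : set T)) (f x)%:E = (expect P (f \_ K))%:E)%E.
    rewrite -EFin_expect// integral_mkcond.
    by apply: eq_integral => x _; rewrite restrict_EFin.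
  by rewrite !e -EFinB lee_fin subr_le0.
split=> [[p1 p2 hp]|[p1 p2 hp]]; split => //.
  by move=> _ [f [cf vf ->]]; rewrite -h//; exact: hp.
by move=> f cf vf; rewrite h//; apply: hp; exists f.
Qed.

End ConvexOrder.

(** * Zero-one law for the first marginal of an extreme pair *)

Section ExtremePairs.
Variables (R : realType) (n : nat) (K : set 'rV[R]_n).
Hypothesis cK : compact K.
Local Notation T := (borelRn R n).
Local Notation D := (@bounded_measurable _ T R).
Local Notation G := (@convex_continuous R n K).
Local Notation C := (@convex_order_pairs R n K).
Implicit Types (p q r : borel_prob R n * borel_prob R n).

Let mK : measurable (K : set T). Proof. exact: compact_borel. Qed.

Lemma extreme_expect p q r (t : R) : extreme_pairs C p -> C q -> C r ->
  0 < t -> t < 1 ->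
  (forall f, D f -> expect p.1 f = t * expect q.1 f + (1 - t) * expect r.1 f) ->
  (forall f, D f -> expect p.2 f = t * expect q.2 f + (1 - t) * expect r.2 f) ->
  forall A : set T, measurable A -> expect q.1 \1_A = expect p.1 \1_A /\
    expect q.2 \1_A = expect p.2 \1_A.
Proof.
move=> [_ ext] Cq Cr t0 t1 h1 h2 A mA.
have [] := ext t q r t0 t1 Cq Cr.
  move=> B mB; have DB := @bounded_measurable_indic _ T R _ mB.
  split; rewrite !(@EFin_expect_indic _ T R _ B)// -!EFinM -EFinD.
    by rewrite h1.
  by rewrite h2.
by move=> qp _; have [e1 e2] := qp A mA; rewrite !expect_indic// e1 e2.
Qed.

(** Domination by [P] makes [L] vanish on [cst 1 - \1_K], whose expectation under [P] is 0. *)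
Lemma dominated_mass (P : borel_prob R n) (L : (T -> R) -> R) :
  P K = 1%E -> linear_on D L ->
  (forall f, D f -> (forall x, 0 <= f x) -> 0 <= L f <= expect P f) ->
  L \1_K = L (cst 1).
Proof.
move=> PK lL dom.
have D1 : D (cst 1) by exact: bounded_measurable_cst.
have DK : D \1_K by exact: bounded_measurable_indic.
have DB : D (cst 1 - \1_K) by exact: bounded_measurableB.
have BZ := @bounded_measurableZ _ T R.
have /andP[] : 0 <= L (cst 1 - \1_K) <= expect P (cst 1 - \1_K).
  apply: dom => // x; change (0 <= 1 - \1_K x :> R).
  by rewrite subr_ge0 indicE lern1 leq_b1.
rewrite (linear_onB BZ lL)// (linear_onB BZ (expect_linear P))//.
by rewrite expect_cst (prob_expect1 P mK).1// subrr; lra.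
Qed.

Lemma normalized_functional (P : borel_prob R n) (L : (T -> R) -> R) (t : R) :
  linear_on D L ->
  (forall f, D f -> (forall x, 0 <= f x) -> 0 <= L f <= expect P f) ->
  0 < t -> L (cst 1) = t ->
  exists Q : borel_prob R n, forall f, D f -> L f = t * expect Q f.
Proof.
move=> lL dom t0 L1.
have [|||Q hQ] := @functional_probability _ T R P (fun f => t^-1 * L f) t^-1.
- by split => [f g Df Dg|s f Df]; rewrite ?lL.1 ?lL.2// ?mulrDr// mulrCA.
- move=> f Df f0; have /andP[h1 h2] := dom f Df f0.
  by rewrite mulr_ge0 ?invr_ge0 ?(ltW t0)//= ler_pM2l ?invr_gt0.
- by rewrite L1 mulVf ?gt_eqF.
by exists Q => f Df; rewrite hQ// mulrA divff ?gt_eqF// mul1r.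
Qed.

Lemma expect_weighted_linear (P : borel_prob R n) (h : T -> R) : D h ->
  linear_on D (fun f => expect P (h * f)).
Proof.
move=> Dh; have [lD lZ] := expect_linear P.
split => [f g Df Dg|t f Df].
  rewrite mulrDr lD//; exact: bounded_measurableM.
rewrite -(lZ t (h * f)); last exact: bounded_measurableM.
congr expect; apply/funext => x; change (h x * (t * f x) = t * (h x * f x)).
exact: mulrCA.
Qed.

Lemma extreme_first_01 p (A : set T) : extreme_pairs C p -> measurable A ->
  p.1 A = 0%E \/ p.1 A = 1%E.
Proof.
move=> ext mA; have [Cp _] := ext.
have [p1K p2K ord] := (convex_order_pairsP p cK).1 Cp.
set mu := p.1 in p1K ord *; set nu := p.2 in p2K ord.
rewrite (fine_probE mu mA); set t := fine (mu A).
have DA : D \1_A by exact: bounded_measurable_indic.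
have DCA : D \1_(~` A) by apply: bounded_measurable_indic; exact: measurableC.
have tE : expect mu \1_A = t by rewrite expect_indic.
have t0 : 0 <= t by exact: fine_ge0.
have t1 : t <= 1.
  rewrite -tE -(expect_cst mu 1); apply: expect_monotone => //.
    exact: bounded_measurable_cst.
  by move=> x; rewrite indicE lern1 leq_b1.
have [->|tn0] := eqVneq t 0; first by left.
have [->|tn1] := eqVneq t 1; first by right.
exfalso.
have {}t0 : 0 < t by rewrite lt_neqAle eq_sym tn0.
have {}t1 : t < 1 by rewrite lt_neqAle tn1.
pose M1 f := expect mu (\1_A * f); pose M2 f := expect mu (\1_(~` A) * f).
have l1 : linear_on D M1 by exact: expect_weighted_linear.
have l2 : linear_on D M2 by exact: expect_weighted_linear.
have DM (h : T -> R) : D h -> forall f, D f -> D (h * f).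
  by move=> Dh f Df; exact: bounded_measurableM.
have M12 f : D f -> M1 f + M2 f = expect mu f.
  move=> Df; rewrite -(expect_linear mu).1; try exact: DM.
  congr expect; apply/funext => x.
  change (\1_A x * f x + \1_(~` A) x * f x = f x).
  rewrite !indicE in_setC; case: (x \in A); rewrite /= ?mul1r ?mul0r ?addr0 ?add0r//.
have dom (B : set T) : measurable B -> forall f, D f -> (forall x, 0 <= f x) ->
    0 <= expect mu (\1_B * f) <= expect mu f.
  move=> mB f Df f0; have DB : D \1_B by exact: bounded_measurable_indic.
  apply/andP; split.
    apply: Rintegral_ge0 => x _; change (0 <= \1_B x * f x).
    by rewrite mulr_ge0// indicE.
  apply: expect_monotone => //; first exact: DM.
  move=> x; change (\1_B x * f x <= f x).
  by rewrite ler_piMl// indicE lern1 leq_b1.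
have dom1 := dom A mA; have dom2 := dom _ (measurableC mA).
have pm L : linear_on D L ->
    (forall f, D f -> (forall x, 0 <= f x) -> 0 <= L f <= expect mu f) ->
    monotone_on D L.
  move=> lL dL; apply: positive_monotone => // f Df f0.
  by have /andP[] := dL f Df f0.
(* [L] is the share of [nu] that dominates [M1] in convex order, while the rest of [nu] dominates
   [M2]. *)
have [L [lL domL L1 L2]] : exists L : (T -> R) -> R,
  [/\ linear_on D L,
      forall f, D f -> (forall x, 0 <= f x) -> 0 <= L f <= expect nu f,
      forall g, G g -> M1 g <= L g &
      forall g, G g -> M2 g <= expect nu g - L g].
  apply: split_functional => //.
  - exact: bounded_measurableD.
  - exact: bounded_measurableZ.
  - exact: bounded_measurable_max.
  - exact: convex_continuous_bounded_measurable.
  - exact: convex_continuous0.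
  - exact: convex_continuousD.
  - exact: convex_continuousZ.
  - exact: convex_continuous_max.
  - exact: expect_linear.
  - exact: expect_monotone.
  - exact: pm.
  - exact: pm.
  - move=> g Gg; rewrite M12; first exact: ord.
    exact: (convex_continuous_bounded_measurable cK).
have D1 : D (cst 1) by exact: bounded_measurable_cst.
have DK : D \1_K by exact: bounded_measurable_indic.
have mul1 (h : T -> R) : h * cst 1 = h by exact: mulr1.
have M1t : M1 (cst 1) = t by rewrite /M1 mul1.
have M2t : M2 (cst 1) = 1 - t by have := M12 _ D1; rewrite expect_cst M1t; lra.
pose L' f := expect nu f - L f.
have lL' : linear_on D L'.
  have [lD lZ] := expect_linear nu; rewrite /L'.
  by split => [f g Df Dg|s f Df]; rewrite ?lD ?lZ ?lL.1 ?lL.2//; ring.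
have domL' f : D f -> (forall x, 0 <= f x) -> 0 <= L' f <= expect nu f.
  by move=> Df f0; have /andP[] := domL f Df f0; rewrite /L'; lra.
(* As [G] contains both [\1_K] and its negative, convex order forces equal masses on [K]; hence [L]
   has total mass [t], like [M1]. *)
have GK : G \1_K by rewrite indic_restrict; exact: convex_continuous_cst.
have GNK : G (- \1_K).
  suff -> : - \1_K = (cst (- 1 : R)) \_ K :> (T -> R) by exact: convex_continuous_cst.
  apply/funext => x; change (- (\1_K x) = ((cst (- 1 : R)) \_ K) x).
  by rewrite indicE /patch; case: (x \in K); rewrite ?oppr0.
have mass M L0 : linear_on D M -> linear_on D L0 -> (forall g, G g -> M g <= L0 g) ->
    M \1_K = L0 \1_K.
  move=> lM l0 h; have := h _ GK; have := h _ GNK.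
  by rewrite -scaleN1r lM.2// l0.2//; lra.
have Lt : L (cst 1) = t.
  by rewrite -(dominated_mass p2K lL domL) -(mass M1 L)// (dominated_mass p1K).
have L't : L' (cst 1) = 1 - t by rewrite /L' expect_cst Lt.
have t1' : 0 < 1 - t by rewrite subr_gt0.
have [mu1 hmu1] := normalized_functional l1 dom1 t0 M1t.
have [mu2 hmu2] := normalized_functional l2 dom2 t1' M2t.
have [nu1 hnu1] := normalized_functional lL domL t0 Lt.
have [nu2 hnu2] := normalized_functional lL' domL' t1' L't.
have inC (s : R) (P Q : borel_prob R n) M L0 : 0 < s ->
    (forall f, D f -> M f = s * expect P f) ->
    (forall f, D f -> L0 f = s * expect Q f) ->
    (forall g, G g -> M g <= L0 g) -> M \1_K = s -> L0 \1_K = s -> C (P, Q).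
  move=> s0 hP hQ h MK L0K; apply/convex_order_pairsP => //; split => /=.
  - apply/(prob_expect1 P mK); apply: (mulfI (lt0r_neq0 s0)).
    by rewrite -hP// mulr1.
  - apply/(prob_expect1 Q mK); apply: (mulfI (lt0r_neq0 s0)).
    by rewrite -hQ// mulr1.
  - move=> g Gg; have Dg := convex_continuous_bounded_measurable cK Gg.
    by rewrite -(ler_pM2l s0) -hP// -hQ//; exact: h.
have C1 : C (mu1, nu1).
  apply: (inC t mu1 nu1 M1 L) => //.
    by rewrite (dominated_mass p1K l1 dom1).
  by rewrite (dominated_mass p2K lL domL).
have C2 : C (mu2, nu2).
  apply: (inC (1 - t) mu2 nu2 M2 L') => //.
    by rewrite (dominated_mass p1K l2 dom2).
  by rewrite (dominated_mass p2K lL' domL').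
have [||e _] := extreme_expect ext C1 C2 t0 t1 _ _ mA.
- by move=> f Df; rewrite -hmu1// -hmu2// M12.
- by move=> f Df; rewrite -hnu1// -hnu2// /L'; ring.
(* Extremality makes [mu1] agree with [mu] on [A], so [M1 \1_A = t * t]; it is also [t], as an
   indicator is its own square. This contradicts [0 < t < 1]. *)
have : M1 \1_A = t * t by rewrite hmu1// [expect mu1 _]e tE.
have -> : M1 \1_A = t.
  rewrite -tE; congr expect; apply/funext => x; change (\1_A x * \1_A x = \1_A x :> R).
  by rewrite indicE; case: (x \in A); rewrite ?mulr1 ?mulr0.
by move=> /eqP; rewrite -{1}(mulr1 t) (inj_eq (mulfI tn0)) eq_sym (negbTE tn1).
Qed.

End ExtremePairs.

(** * Finitely supported measures *)

Section FiniteSupport.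
Variables (R : realType) (n : nat).
Local Notation T := (borelRn R n).
Local Notation V := 'rV[R]_n.
Implicit Types (P : borel_prob R n).

Lemma compact_cover_seq (K : set V) (U : V -> set V) : compact K ->
  (forall x, K x -> open (U x) /\ U x x) ->
  exists s : seq V, (forall x, x \in s -> K x) /\
    forall z, K z -> exists2 x, x \in s & U x z.
Proof.
rewrite compact_cover => cK hU.
have [||D' D'K D'U] := cK V K U.
- by move=> x Kx; have [] := hU x Kx.
- by move=> x Kx; exists x => //; have [] := hU x Kx.
exists (finmap.enum_fset D'); split=> [x xD|z /D'U[x xD Uxz]]; last by exists x.
by have := D'K x xD; rewrite inE.
Qed.

Lemma ball_borel (x : V) (r : R) : measurable (ball x r : set T).
Proof. by apply: open_borel; exact: ball_open. Qed.

Lemma separating_radius m (s : 'I_m -> V) : injective s ->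
  exists2 r : R, 0 < r &
    forall i j x, ball (s i) r x -> ball (s j) r x -> i = j.
Proof.
move=> sI.
pose F (ij : 'I_m * 'I_m) := `|s ij.1 - s ij.2| / 2.
(* Half the least distance between two of the points, capped at 1, which also settles the case of no
   pair. *)
exists (\big[Num.min/(1 : R)]_(ij | ij.1 != ij.2) F ij).
  apply: lt_bigmin => // -[i j] /= ij; rewrite divr_gt0// normr_gt0 subr_eq0.
  by apply: contra ij => /eqP/sI /= ->.
move=> i j x; rewrite -ball_normE /= => hi hj; apply/eqP; apply: contraT => ij.
have := @bigmin_le_cond _ _ _ 1 (i, j) (fun ij => ij.1 != ij.2) F ij.
rewrite /F /= => h.
have : `|s i - s j| <= `|s i - x| + `|s j - x|.
  by rewrite -[in leRHS](normrN (s j - x)) opprB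
    (le_trans _ (ler_normD _ _))// addrA subrK.
move: h hi hj; set r := \big[_/_]_(_ | _) _; lra.
Qed.

(** Compactness extracts a finite cover by null balls. *)
Lemma locally_null P (F : set V) : compact F ->
  (forall x, F x -> exists2 r : R, 0 < r & P (ball x r) = 0%E) ->
  P.-negligible (F : set T).
Proof.
move=> cF h.
have /choice[r hr] : forall x, exists r : R, F x -> 0 < r /\ P (ball x r) = 0%E.
  move=> x.
  have [Fx|nFx] := pselect (F x); last by exists 0.
  by have [r r0 Pr] := h x Fx; exists r.
have [|s [sF sU]] := @compact_cover_seq F (fun x => ball x (r x)) cF.
  move=> x Fx; have [r0 _] := hr x Fx.
  by split; [exact: ball_open|exact: ballxx].
apply: (@negligibleS _ _ _ _ (\big[setU/set0]_(x <- s) (ball x (r x) : set T))).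
  by move=> z /sU[x xs zx]; rewrite -bigcup_seq; exists x.
rewrite big_seq; elim/big_ind : _ => [||x xs].
- exact: negligible_set0.
- by move=> A B; exact: negligibleU.
- apply/negligibleP; first exact: ball_borel.
  by have [_] := hr x (sF x xs).
Qed.

Lemma atomic_measure P m (s : 'I_m -> T) : injective s ->
  P.-negligible (~` range s) -> forall B : set T, measurable B ->
  P B = (\sum_(i < m) P [set s i] * \d_(s i) B)%E.
Proof.
move=> sI nul B mB.
have UE (E : set T) : E `&` range s = \big[setU/set0]_(i < m) (E `&` [set s i]).
  rewrite -bigcup_seq; apply/seteqP; split => [x [Ex [i _ e]]|x [i _ [Ex /= e]]].
    by exists i; [exact: mem_index_enum|split => //=; rewrite e].
  by split => //; exists i.
have mi (E : set T) i : measurable E -> measurable (E `&` [set s i]).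
  by move=> mE; apply: measurableI => //; exact: set1_borel.
have ms : measurable (range s).
  by rewrite -[range s]setTI UE; apply: bigsetU_measurable => i _; exact: mi.
have -> : P B = P (B `&` range s).
  apply: etrans (measureDI P mB ms) _.
  have sub : B `\` range s `<=` ~` range s by move=> x [].
  by rewrite (measure_negligible (measurableD mB ms) (negligibleS sub nul)) add0e.
rewrite UE measure_bigsetU_ord//; last first.
  by move=> i j _ _ [x [[_ ->] [_ /sI]]].
  by move=> i; exact: mi.
apply: eq_bigr => i _; rewrite diracE.
have [Bi|Bi] := boolP (s i \in B).
  rewrite mule1; congr (P _); apply/seteqP; split => [x [_ ->]//|x /= ->].
  by rewrite inE in Bi.
rewrite mule0 (_ : _ `&` _ = set0) ?measure0//.
by apply/seteqP; split => x // [Bx /= e]; rewrite e in Bx; move: Bi; rewrite mem_set.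
Qed.

(** Both sides are linear and monotone in [f], so agreement on indicators suffices. *)
Lemma atomic_expect P m (s : 'I_m -> T) (w : 'I_m -> R) :
  (forall B : set T, measurable B ->
    P B = (\sum_(i < m) (w i)%:E * \d_(s i) B)%E) ->
  (forall i, 0 <= w i) ->
  forall f, @bounded_measurable _ T R f -> expect P f = \sum_(i < m) w i * f (s i).
Proof.
move=> PE w0; apply: linear_on_eq_indic.
- exact: expect_linear.
- split=> [f g _ _|t f _].
    by rewrite -big_split; apply: eq_bigr => i _; exact: mulrDr.
  rewrite big_distrr; apply: eq_bigr => i _; exact: mulrCA.
- exact: expect_monotone.
- by move=> f g _ _ fg; apply: ler_sum => i _; exact: ler_wpM2l.
- move=> A mA; rewrite expect_indic// PE//.
  under eq_bigr do rewrite diracE -EFinM.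
  by rewrite sumEFin.
Qed.

(** The topological support [S] has at most [N] points, since small disjoint balls around [N.+1] of
    them would all have positive measure. Compact sets that miss the support are null, so [P] is
    carried by it. *)
Lemma finite_support P (K : set V) (N : nat) : compact K -> P K = 1%E ->
  (forall A : 'I_N.+1 -> set T, (forall i, measurable (A i)) ->
    trivIset setT A -> exists i, P (A i) = 0%E) ->
  exists m (s : 'I_m -> V), [/\ (m <= N)%N, injective s, forall i, K (s i),
    forall i, 0 < fine (P [set s i]) &
    forall B : set T, measurable B ->
      P B = (\sum_(i < m) (fine (P [set s i]))%:E * \d_(s i : T) B)%E].
Proof.
move=> cK PK hN.
pose S := [set x : V | forall r : R, 0 < r -> P (ball x r) != 0%E].
pose Q m := `[< exists s : seq V, [/\ uniq s, size s = m & forall x, x \in s -> S x] >].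
have Q0 : exists m, Q m by exists 0%N; apply/asboolP; exists [::].
have QN m : Q m -> (m <= N)%N.
  move=> /asboolP[s [us sm sS]]; rewrite leqNgt; apply/negP => Nm.
  pose f (i : 'I_N.+1) := nth 0 s i.
  have fS i : S (f i).
    by apply: sS; apply: mem_nth; rewrite sm; exact: leq_trans (ltn_ord i) Nm.
  have fI : injective f.
    move=> i j /eqP; rewrite nth_uniq// ?sm.
    - by move=> /eqP/val_inj.
    - exact: leq_trans (ltn_ord i) Nm.
    - exact: leq_trans (ltn_ord j) Nm.
  have [r r0 sep] := separating_radius fI.
  have [||i] := hN (fun i => ball (f i) r : set T).
  - by move=> i; exact: ball_borel.
  - by move=> i j _ _ [x [xi xj]]; exact: sep xi xj.
  by move=> /eqP; apply/negP; exact: fS.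
have [m /asboolP[s0 [us0 sm sS]] mmax] := ex_maxnP Q0 QN.
pose s (i : 'I_m) : V := nth 0 s0 i.
have ss0 i : s i \in s0 by apply: mem_nth; rewrite sm.
have sI : injective s.
  by move=> i j /eqP; rewrite nth_uniq ?sm// => /eqP/val_inj.
have [r r0 sep] := separating_radius sI.
(* A further support point would lengthen the list [s0], against the maximality of [m]. *)
have Ssub x : S x -> range s x.
  move=> Sx; apply: contrapT => nx.
  have : (m.+1 <= m)%N; last by rewrite ltnn.
  apply: mmax; apply/asboolP; exists (x :: s0); split.
  - rewrite /= us0 andbT; apply/negP => xs0; apply: nx.
    have xm : (index x s0 < m)%N by rewrite -sm index_mem.
    by exists (Ordinal xm) => //; exact: nth_index.
  - by rewrite /= sm.
  - by move=> y; rewrite inE => /predU1P[->//|]; exact: sS.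
have nK : P.-negligible (~` K : set T).
  apply/negligibleP; first by apply: measurableC; exact: compact_borel.
  apply: etrans (probability_setC P _) _; first exact: compact_borel.
  by rewrite PK subee.
have nul : P.-negligible (~` range s : set T).
  (* Each [F k] is compact and misses the support; together they exhaust [K] without the points
     [s i]. *)
  pose F k := K `\` \bigcup_(i in [set: 'I_m]) ball (s i) (k.+1%:R^-1 : R).
  have nF k : P.-negligible (F k : set T).
    apply: locally_null => [|x [Kx nx]].
      apply: compact_closedI => //.
      by apply: open_closedC; apply: bigcup_open => i _; exact: ball_open.
    have nSx : ~ S x.
      by move=> /Ssub[i _ e]; apply: nx; exists i => //; rewrite e; exact: ballxx.
    move/existsNP: nSx => [r' /not_implyP[r'0 /negP/negPn/eqP h]].
    by exists r'.
  apply: negligibleS (negligibleU nK (negligible_bigcup nF)) => x nx.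
  have [Kx|] := pselect (K x); last by left.
  (* With this [k], [1 / (k + 1)] is smaller than the distance from [x] to every [s i]. *)
  right; pose k := (\max_(i < m) Num.truncn (`|s i - x|^-1)%R)%N.
  exists k => //; split => // -[i _]; rewrite -ball_normE /= => h.
  have d0 : 0 < `|s i - x|.
    by rewrite normr_gt0 subr_eq0; apply/eqP => e; apply: nx; exists i.
  have : `|s i - x|^-1 < k.+1%:R.
    apply: lt_le_trans (truncnS_gt _) _; rewrite ler_nat ltnS.
    exact: (@leq_bigmax _ (fun i => Num.truncn (`|s i - x|^-1)%R)).
  by rewrite invf_plt ?posrE// ltNge (ltW h).
have mul1 B : measurable B ->
    P B = (\sum_(i < m) (fine (P [set s i]))%:E * \d_(s i : T) B)%E.
  move=> mB; rewrite (atomic_measure sI nul mB); apply: eq_bigr => i _.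
  by rewrite -fine_probE//; exact: set1_borel.
(* The ball of radius [r] about [s i] contains no other [s j], so its mass, nonzero at a support
   point, is that of the atom. *)
have pos i : 0 < fine (P [set s i]).
  rewrite lt_neqAle fine_ge0// andbT eq_sym; apply/negP => /eqP e0.
  have := sS _ (ss0 i) r r0; rewrite (mul1 _ (ball_borel _ _)) big1 ?eqxx// => j _.
  rewrite diracE; case: (boolP (_ \in _)); rewrite ?mule0// inE => h.
  by rewrite -(sep i j _ h (ballxx _ r0)) e0 mul0e.
have mN : (m <= N)%N by apply: QN; apply/asboolP; exists s0.
exists m, s; split => //.
move=> i; apply: contrapT => nKi; have := pos i.
suff -> : fine (P [set s i]) = 0 by rewrite ltxx.
suff e : P [set s i] = 0%E by rewrite e.
apply: measure_negligible; first exact: set1_borel.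
by apply: negligibleS nK => x ->.
Qed.

End FiniteSupport.

(** * Jensen's inequality *)

Section Jensen.
Variables (R : realType) (n : nat) (K : set 'rV[R]_n).
Hypotheses (cK : compact K) (vK : convex_set K).
Local Notation T := (borelRn R n).
Local Notation V := 'rV[R]_n.
Local Notation D := (@bounded_measurable _ T R).
Implicit Types (P : borel_prob R n).

Lemma convex_combination (f : V -> R) m (y : 'I_m -> V) (w : 'I_m -> R) :
  convex_function K f -> (forall i, K (y i)) -> (forall i, 0 <= w i) ->
  \sum_(i < m) w i = 1 ->
  K (\sum_(i < m) w i *: y i) /\
  f (\sum_(i < m) w i *: y i) <= \sum_(i < m) w i * f (y i).
Proof.
move=> vf Ky w0 w1.
(* Normalising by the total weight makes the claim stable under dropping the last weight, after
   which the sum is no longer 1. *)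
suff H : 0 < \sum_(i < m) w i ->
    K ((\sum_(i < m) w i)^-1 *: \sum_(i < m) w i *: y i) /\
    f ((\sum_(i < m) w i)^-1 *: \sum_(i < m) w i *: y i) <=
      (\sum_(i < m) w i)^-1 * \sum_(i < m) w i * f (y i).
  by move: H; rewrite w1 ltr01 invr1 scale1r mul1r; exact.
elim: m y w Ky w0 {w1} => [|m IH] y w Ky w0; first by rewrite big_ord0 ltxx.
rewrite !big_ord_recr /=.
set W := \sum_(i < m) _; set Y := \sum_(i < m) _ *: _; set F := \sum_(i < m) _ * _.
set u := w _; set z := y _.
have W0 : 0 <= W by apply: sumr_ge0.
have u0 : 0 <= u by exact: w0.
have Kz : K z by exact: Ky.
(* If [W = 0], all earlier weights vanish and the combination reduces to [z]. *)
have [We|Wn0] := eqVneq W 0.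
  have w00 i : w (widen_ord (leqnSn m) i) = 0.
    by have := psumr_eq0P (fun i _ => w0 (widen_ord (leqnSn m) i)) We; exact.
  have -> : Y = 0 by apply: big1 => i _; rewrite w00 scale0r.
  have -> : F = 0 by apply: big1 => i _; rewrite w00 mul0r.
  rewrite We !add0r => up; have un0 : u != 0 by rewrite gt_eqF.
  by rewrite scalerA mulVf// scale1r mulrA mulVf// mul1r.
have Wp : 0 < W by rewrite lt_neqAle eq_sym Wn0.
have [KY fY] := IH _ _ (fun i => Ky (widen_ord (leqnSn m) i))
  (fun i => w0 (widen_ord (leqnSn m) i)) Wp.
rewrite -/W -/Y in KY fY; rewrite -/F in fY.
move=> Wup; have Wun0 : W + u != 0 by rewrite gt_eqF.
pose t := W / (W + u).
have t0 : 0 <= t by rewrite divr_ge0// ltW.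
have t1 : t <= 1 by rewrite ler_pdivrMr// mul1r lerDl.
have t1E : 1 - t = u / (W + u).
  by rewrite /t -[X in X - _](divff Wun0) -mulrBl addrAC subrr add0r.
have e : (W + u)^-1 *: (Y + u *: z) = t *: (W^-1 *: Y) + (1 - t) *: z.
  by rewrite t1E scalerDr !scalerA /t mulrAC divff// mul1r [u / _]mulrC.
rewrite e; split; first exact: ((convex_setP K).1 vK).
apply: le_trans ((convex_functionP K f).1 vf _ _ t KY Kz t0 t1) _.
have -> : (W + u)^-1 * (F + u * f z) = t * (W^-1 * F) + (1 - t) * f z.
  by rewrite t1E /t; field; rewrite Wn0 Wun0.
by rewrite lerD2r; exact: ler_wpM2l.
Qed.

Lemma fine_partition (U : V -> set V) :
  (forall x, K x -> open (U x) /\ U x x) ->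
  exists m (y : 'I_m -> V) (A : 'I_m -> set T),
    [/\ forall i, K (y i), forall i, measurable (A i),
        trivIset setT A, forall i, A i `<=` K `&` U (y i) &
        forall z, K z -> exists i, A i z].
Proof.
move=> hU; have [s [sK sU]] := compact_cover_seq cK hU.
(* [seqDU], which makes the cover disjoint, acts on sequences indexed by [nat]; the cover is
   continued by empty sets. *)
pose F (i : nat) : set T := if (i < size s)%N then K `&` U (nth 0 s i) else set0.
have mF i : measurable (F i).
  rewrite /F; case: ltnP => // si; apply: measurableI; first exact: compact_borel.
  by apply: open_borel; have [] := hU _ (sK _ (mem_nth 0 si)).
exists (size s), (fun i => nth 0 s i), (fun i => seqDU F i); split.
- by move=> i; apply: sK; exact: mem_nth.
- move=> i; apply: measurableD => //; apply: bigsetU_measurable => j _; exact: mF.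
- move=> i j _ _ h; apply/val_inj.
  exact: (@trivIset_seqDU _ F i j Logic.I Logic.I h).
- by move=> i; apply: subset_trans (@subset_seqDU _ F i) _; rewrite /F ltn_ord.
- move=> z Kz; have [x xs Uxz] := sU z Kz.
  have : (\bigcup_k F k) z.
    exists (index x s) => //; rewrite /F index_mem xs; split => //.
    by rewrite nth_index.
  rewrite seqDU_bigcup_eq => -[k _ Fk].
  have ks : (k < size s)%N.
    by have := subset_seqDU Fk; rewrite /F; case: ltnP.
  by exists (Ordinal ks).
Qed.

(* The same weights [w], the masses of the cells of a partition of [K], serve
   for [f] and for all the coordinates. *)
Lemma barycentre_approx P (f : V -> R) (eps : R) : P K = 1%E ->
  {within K, continuous f} -> 0 < eps ->
  exists m (y : 'I_m -> V) (w : 'I_m -> R),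
    [/\ forall i, K (y i), forall i, 0 <= w i, \sum_(i < m) w i = 1,
        `|expect P (f \_ K) - \sum_(i < m) w i * f (y i)| <= eps &
        forall k, `|expect P (coord K k) - \sum_(i < m) w i * y i ord0 k| <= eps].
Proof.
move=> PK cf e0.
(* One neighbourhood controls [f] on [K] and every coordinate, balls of row vectors being
   coordinatewise. *)
have near_f x : exists U : set V, K x ->
    [/\ open U, U x, forall z, K z -> U z -> `|f z - f x| <= eps &
        forall z k, U z -> `|z ord0 k - x ord0 k| <= eps].
  have [Kx|nKx] := pselect (K x); last by exists set0.
  have cfx := (subspace_continuousP K f).1 cf x Kx.
  have /cvgrPdist_le/(_ eps e0) := cfx.
  rewrite near_withinE /= => /nbhs_interior hU.
  exists ([set z | K z -> `|f x - f z| <= eps]° `&` ball x eps) => _; split.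
  - by apply: openI; [exact: open_interior|exact: ball_open].
  - by split; [exact: nbhs_singleton hU|exact: ballxx].
  - by move=> z Kz [/interior_subset h _]; rewrite distrC; exact: h.
  - move=> z k [_ [_ /(_ ord0 k)]]; rewrite -ball_normE /= distrC.
    exact: ltW.
have [U hU] := choice near_f.
have [|m [y [A [yK mA tA AU Acov]]]] := @fine_partition U.
  by move=> x Kx; have [] := hU x Kx.
have DA i : D \1_(A i) by exact: bounded_measurable_indic.
have sumA (c : 'I_m -> R) i z : A i z -> \sum_j c j * \1_(A j) z = c i.
  move=> Aiz; rewrite (bigD1 i)//= indicE mem_set// mulr1 big1 ?addr0// => j ji.
  rewrite indicE memNset ?mulr0// => Ajz.
  by move/eqP: ji; apply; apply: tA => //; exists z.
have sumA0 (c : 'I_m -> R) z : ~ K z -> \sum_j c j * \1_(A j) z = 0.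
  move=> nKz; apply: big1 => j _; rewrite indicE memNset ?mulr0//.
  by move=> /AU[].
pose w i := expect P \1_(A i).
have approx (g : V -> R) : D (g \_ K) ->
    (forall i z, A i z -> `|g z - g (y i)| <= eps) ->
    `|expect P (g \_ K) - \sum_(i < m) w i * g (y i)| <= eps.
  move=> Dg hg.
  (* The step function with value [g (y i)] on the cell [A i]; off [K] it vanishes like [g \_ K]. *)
  pose h : T -> R := \sum_(i < m) g (y i) *: \1_(A i).
  have Dh : D h by apply: bounded_measurable_sum => i; exact: bounded_measurableZ.
  have hE z : h z = \sum_(i < m) g (y i) * \1_(A i) z.
    by rewrite /h fct_sumE.
  have -> : \sum_(i < m) w i * g (y i) = expect P h.
    rewrite (linear_on_sum _ (expect_linear P)); last first.
      by move=> i; exact: bounded_measurableZ.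
    by apply: eq_bigr => i _; rewrite (expect_linear P).2// mulrC.
  rewrite -(linear_onB (@bounded_measurableZ _ T R) (expect_linear P))//.
  have Ddiff : D (g \_ K - h) by exact: bounded_measurableB.
  have Dc (r : R) : D (cst r) by exact: bounded_measurable_cst.
  have bound z : `|(g \_ K - h) z| <= eps.
    change (`|(g \_ K) z - h z| <= eps); rewrite hE.
    have [Kz|nKz] := pselect (K z).
      have [i Aiz] := Acov z Kz.
      by rewrite (sumA (fun j => g (y j)) i z Aiz) patchE mem_set//; exact: hg.
    by rewrite sumA0// patchE memNset// subr0 normr0 ltW.
  rewrite ler_norml -{1}(expect_cst P (- eps)) -{2}(expect_cst P eps).
  apply/andP; split; apply: expect_monotone => // z;
    by have := bound z; rewrite ler_norml => /andP[].
exists m, y, w; split => //.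
- by move=> i; apply: Rintegral_ge0 => x _; rewrite indicE.
- rewrite -((prob_expect1 P (compact_borel cK)).1 PK).
  rewrite -(linear_on_sum _ (expect_linear P))//.
  congr expect; apply/funext => z; rewrite fct_sumE.
  have [Kz|nKz] := pselect (K z).
    have [i Aiz] := Acov z Kz.
    rewrite [RHS]indicE mem_set//; apply: etrans (sumA (fun=> 1) i z Aiz).
    by apply: eq_bigr => j _; rewrite mul1r.
  rewrite [RHS]indicE memNset//; apply: etrans (sumA0 (fun=> 1) z nKz).
  by apply: eq_bigr => j _; rewrite mul1r.
- apply: approx; first exact: within_continuous_bounded_measurable.
  move=> i z Aiz; have [Kz Uz] := AU i z Aiz.
  by have [_ _ h _] := hU _ (yK i); exact: h.
- move=> k; apply: (approx (fun z => z ord0 k)).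
    exact: (convex_continuous_bounded_measurable cK (convex_continuous_coord K k)).
  move=> i z Aiz; have [Kz Uz] := AU i z Aiz.
  by have [_ _ _ h] := hU _ (yK i); exact: h.
Qed.

(** The finite inequality holds at convex combinations arbitrarily close to [x] whose averages of
    [f] are close to its expectation. Closedness of [K] and continuity of [f] on [K] pass it to the
    limit. *)
Theorem Jensen P (x : V) : P K = 1%E ->
  (forall k, expect P (coord K k) = x ord0 k) ->
  K x /\ forall f : V -> R, {within K, continuous f} -> convex_function K f ->
    f x <= expect P (f \_ K).
Proof.
move=> PK bar.
have close (f : V -> R) (eps : R) : {within K, continuous f} -> convex_function K f ->
    0 < eps -> exists x', [/\ K x', ball x eps x' & f x' <= expect P (f \_ K) + eps].
  move=> cf vf e0; have e2 : 0 < eps / 2 by rewrite divr_gt0.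
  have [m [y [w [Ky w0 w1 hf hx]]]] := barycentre_approx PK cf e2.
  have [Kx' fx'] := convex_combination vf Ky w0 w1.
  exists (\sum_(i < m) w i *: y i); split => //.
    split => // i k; rewrite ord1; have := hx k; rewrite bar -ball_normE /= summxE.
    under [X in `|_ - X| <= _ -> _]eq_bigr do rewrite -[w _ * _]/(w _ *: _).
    move=> h; apply: le_lt_trans (_ : _ <= eps / 2) _; last by lra.
    by under eq_bigr do rewrite mxE.
  by apply: le_trans fx' _; move: hf; rewrite ler_norml => /andP[]; lra.
have Kx : K x.
  (* For membership in [K] only the closeness of [x'] to [x] matters, so [f] is taken to be 0. *)
  have ccst : {within K, continuous (cst 0 : V -> R)}.
    by apply: continuous_subspaceT; exact: cst_continuous.
  have vcst : convex_function K (cst 0 : V -> R).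
    by apply/convex_functionP => *; rewrite /cst; lra.
  apply: (compact_closed_rV cK) => B /nbhs_ballP[eps /= e0 hB].
  have [x' [Kx' bx _]] := close _ eps ccst vcst e0.
  by exists x'; split => //; exact: hB.
split => // f cf vf; apply/ler_addgt0Pr => eps e0.
have e2 : 0 < eps / 2 by rewrite divr_gt0.
have /cvgrPdist_le/(_ _ e2) := (subspace_continuousP K f).1 cf x Kx.
rewrite near_withinE => /nbhs_ballP[d /= d0 hd].
have [] := close f (Num.min d (eps / 2)) cf vf; first by rewrite lt_min d0.
move=> x' [Kx' bx fx'].
have bd : ball x d x' by apply: le_ball bx; rewrite ge_min lexx.
have := hd x' bd Kx'; rewrite ler_norml => /andP[_ h].
have : Num.min d (eps / 2) <= eps / 2 by rewrite ge_min lexx orbT.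
lra.
Qed.

End Jensen.

(** * Affine independence as absence of affine dependences *)

Section AffineIndependence.
Variables (R : realType) (n : nat).
Local Notation V := 'rV[R]_n.

Lemma affinely_independentP m (xs : 'I_m -> V) : affinely_independent xs <->
  forall c : 'I_m -> R, \sum_i c i = 0 -> \sum_i c i *: xs i = 0 ->
    forall i, c i = 0.
Proof.
split=> [ind c c0 cx i|ind i [k [p [w [pE w1 e]]]]].
  apply/eqP; apply: contraT => ci; exfalso; apply: (ind i).
  (* Solve the dependence for [xs i], dividing by [- c i]; [lift i] runs through the [m.-1] other
     indices. *)
  exists m.-1, (fun a => xs (lift i a)), (fun a => - c (lift i a) / c i); split.
  - by move=> a; exists (lift i a) => //=; rewrite eq_sym neq_lift.
  - rewrite -mulr_suml sumrN; move: c0; rewrite (bigD1_ord i)//= => /eqP.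
    by rewrite addr_eq0 => /eqP <-; rewrite divff.
  - apply: (scalerI ci); rewrite scaler_sumr.
    move: cx; rewrite (bigD1_ord i)//= => /eqP; rewrite addr_eq0 => /eqP ->.
    rewrite -sumrN; apply: eq_bigr => a _.
    by rewrite scalerA mulrCA divff// mulr1 scaleNr.
have /choice[J hJ] : forall a, exists j, j != i /\ xs j = p a.
  by move=> a; have [j ji ej] := pE a; exists j.
(* The points [p a] may repeat, so their weights are collected by index. No [J a] equals [i], whence
   [c i = -1], although [c] is an affine dependence. *)
pose c j := \sum_(a < k | J a == j) w a - (j == i)%:R.
have /ind/(_ _ i) : \sum_j c j = 0.
  rewrite /c big_split /= sumrN.
  have -> : \sum_j \sum_(a < k | J a == j) w a = 1.
    by rewrite -w1 [RHS](partition_big J predT).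
  by rewrite (bigD1 i)//= eqxx big1 ?addr0 ?subrr// => j /negbTE ->.
move=> ci; have : c i = -1.
  rewrite /c eqxx big1 ?add0r// => a /eqP Ja; have [+ _] := hJ a.
  by rewrite Ja eqxx.
rewrite ci; first by move=> /eqP; rewrite eq_sym oppr_eq0 oner_eq0.
rewrite /c; under eq_bigr do rewrite scalerBl scaler_suml.
rewrite big_split /= sumrN; apply/eqP; rewrite subr_eq0; apply/eqP.
rewrite [RHS](bigD1 i)//= eqxx scale1r [X in _ = _ + X]big1 ?addr0; last first.
  by move=> j /negbTE ->; rewrite scale0r.
rewrite e (partition_big J predT)//=; apply: eq_bigr => j _.
by apply: eq_bigr => a /eqP <-; have [_ ->] := hJ a.
Qed.

End AffineIndependence.

(** * Perturbing the second marginal over a Dirac mass *)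

Section DiracExtreme.
Variables (R : realType) (n : nat) (K : set 'rV[R]_n).
Hypotheses (cK : compact K) (vK : convex_set K).
Local Notation T := (borelRn R n).
Local Notation V := 'rV[R]_n.
Local Notation D := (@bounded_measurable _ T R).
Local Notation G := (@convex_continuous R n K).
Local Notation C := (@convex_order_pairs R n K).
Implicit Types (p q r : borel_prob R n * borel_prob R n) (P Q : borel_prob R n).

Let D1 : D (cst 1). Proof. exact: bounded_measurable_cst. Qed.

Let Dcoord k : D (coord K k).
Proof.
exact: (convex_continuous_bounded_measurable cK (convex_continuous_coord K k)).
Qed.

Let DN (h : T -> R) : D h -> D (- h).
Proof. by move=> Dh; rewrite -scaleN1r; exact: bounded_measurableZ. Qed.

Lemma coordE (x : V) k : K x -> coord K k x = x ord0 k.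
Proof. by move=> Kx; rewrite /coord patchE mem_set. Qed.

(** A coordinate and its negative are both convex. *)
Lemma convex_order_coord p k : C p ->
  expect p.2 (coord K k) = expect p.1 (coord K k).
Proof.
move=> /(convex_order_pairsP p cK)[_ _ h].
have := h _ (convex_continuous_coord K k); have := h _ (convex_continuous_coordN K k).
by rewrite -scaleN1r !(expect_linear _).2//; lra.
Qed.

Lemma dirac_convex_order p (x : V) :
  (forall f, D f -> expect p.1 f = f x) -> p.2 K = 1%E ->
  (forall k, expect p.2 (coord K k) = x ord0 k) -> C p.
Proof.
move=> px p2 bar; have [Kx jen] := Jensen cK vK p2 bar.
have mK := compact_borel cK.
apply/convex_order_pairsP => //; split => //.
  apply/(prob_expect1 p.1 mK); rewrite px; last exact: bounded_measurable_indic.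
  by rewrite indicE mem_set.
move=> g Gg; have Dg := convex_continuous_bounded_measurable cK Gg; rewrite px//.
by have [f [cf vf ->]] := Gg; rewrite patchE mem_set//; exact: jen.
Qed.

(** [Q] has density [1 + h] with respect to [P]: this is nonnegative, at most 2, and of integral
    1. *)
Lemma tilt P (h : T -> R) : D h -> (forall x, `|h x| <= 1) -> expect P h = 0 ->
  exists Q, forall f, D f -> expect Q f = expect P f + expect P (h * f).
Proof.
move=> Dh h1 h0; have [eD eZ] := expect_linear P.
have [wD wZ] := expect_weighted_linear P Dh.
apply: (@functional_probability _ T R P _ 2).
- by split => [f g Df Dg|t f Df]; rewrite ?eD ?eZ ?wD ?wZ//; ring.
- move=> f Df f0.
  have Dhf : D (h * f) by exact: bounded_measurableM.
  have le1 x : `|h x * f x| <= f x by rewrite normrM (ger0_norm (f0 x)) ler_piMl.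
  have : expect P (- f) <= expect P (h * f).
    apply: expect_monotone => // [|x]; first exact: DN.
    by have := le1 x; rewrite ler_norml => /andP[].
  have : expect P (h * f) <= expect P f.
    by apply: expect_monotone => // x; have := le1 x; rewrite ler_norml => /andP[].
  by rewrite -scaleN1r eZ//; lra.
- by rewrite expect_cst (_ : h * cst 1 = h) ?h0 ?addr0//; exact: mulr1.
Qed.

Lemma extreme_no_tilt p (x : V) (h : T -> R) : extreme_pairs C p ->
  (forall f, D f -> expect p.1 f = f x) ->
  D h -> expect p.2 h = 0 -> (forall k, expect p.2 (h * coord K k) = 0) ->
  forall A : set T, measurable A -> expect p.2 (h * \1_A) = 0.
Proof.
move=> ext px Dh h0 hk A mA; have [Cp _] := ext.
have [p1K p2K _] := (convex_order_pairsP p cK).1 Cp.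
have mK := compact_borel cK.
have Kx : K x.
  have := (prob_expect1 p.1 mK).1 p1K; rewrite px; last exact: bounded_measurable_indic.
  rewrite indicE; have [|_ /eqP] := boolP (x \in K); first by rewrite inE.
  by rewrite eq_sym oner_eq0.
(* All conditions on [h] are homogeneous, so it may be rescaled; [|M| + 1] is a nonzero divisor. *)
wlog h1 : h Dh h0 hk / forall x, `|h x| <= 1.
  move=> H; have [_ [M hM]] := Dh.
  pose e := (`|M| + 1)^-1; have e0 : 0 < e by rewrite invr_gt0 ltr_wpDl.
  have eh f : (e *: h) * f = e *: (h * f).
    by apply/funext => z; exact: (esym (mulrA e (h z) (f z))).
  have DA : D \1_A by exact: bounded_measurable_indic.
  have Dhf f : D f -> D (h * f) by exact: bounded_measurableM.
  have := H (e *: h); rewrite eh !(expect_linear _).2//; last exact: Dhf.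
  move=> H'; apply: (mulfI (lt0r_neq0 e0)); rewrite mulr0; apply: H'.
  - exact: bounded_measurableZ.
  - by rewrite h0 mulr0.
  - move=> k; rewrite eh (expect_linear _).2//; last exact: Dhf.
    by rewrite hk mulr0.
  - move=> z; change (`|e * h z| <= 1); rewrite normrM (ger0_norm (ltW e0)).
    rewrite mulrC ler_pdivrMr ?ltr_wpDl// mul1r (le_trans (hM z))//.
    by rewrite (le_trans (ler_norm _))// lerDl.
have DNh := DN Dh.
have NhE f : (- h) * f = - (h * f) by exact: mulNr.
have eN f : D f -> expect p.2 (- f) = - expect p.2 f.
  by move=> Df; rewrite -scaleN1r (expect_linear _).2// mulN1r.
have Dhf f : D f -> D (h * f) by exact: bounded_measurableM.
have [Q hQ] := tilt Dh h1 h0.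
have [|| Q' hQ'] := @tilt p.2 (- h) DNh.
- by move=> z; change (`|- h z| <= 1); rewrite normrN.
- by rewrite eN// h0 oppr0.
have {}hQ' f : D f -> expect Q' f = expect p.2 f - expect p.2 (h * f).
  by move=> Df; rewrite hQ'// NhE eN//; exact: Dhf.
have bar k : expect p.2 (coord K k) = x ord0 k.
  by rewrite (convex_order_coord k Cp) px// coordE.
have DK : D \1_K by exact: bounded_measurable_indic.
(* Since [p.2] has no mass off [K], tilting by [h] or [- h] leaves mass 1 on [K]. *)
have hK : expect p.2 (h * \1_K) = 0.
  have DCK : D (cst 1 - \1_K) by exact: bounded_measurableB.
  have e : expect p.2 (cst 1 - \1_K) = 0.
    rewrite (linear_onB (@bounded_measurableZ _ T R) (expect_linear _))//.
    by rewrite expect_cst (prob_expect1 _ mK).1// subrr.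
  have : `|expect p.2 (h * (cst 1 - \1_K))| <= expect p.2 (cst 1 - \1_K).
    rewrite ler_norml -eN//; apply/andP; split; apply: expect_monotone => //;
      do ?[exact: DN | exact: Dhf];
      move=> z; (have : `|h z * (1 - \1_K z)| <= 1 - \1_K z;
        [rewrite normrM [X in _ * X]ger0_norm ?ler_piMl// subr_ge0 indicE lern1 leq_b1
        |rewrite ler_norml => /andP[h2 h3]]).
      exact: h2.
    exact: h3.
  rewrite e normr_le0 => /eqP.
  rewrite mulrBr (linear_onB (@bounded_measurableZ _ T R) (expect_linear _));
    try exact: Dhf.
  rewrite (_ : h * cst 1 = h) ?h0 ?sub0r; last exact: mulr1.
  by move/eqP; rewrite oppr_eq0 => /eqP.
have CQ : C (p.1, Q).
  apply: (dirac_convex_order (x := x)) => //= [|k].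
    by apply/(prob_expect1 Q mK); rewrite hQ// hK addr0; exact/(prob_expect1 _ mK).
  by rewrite hQ// hk addr0.
have CQ' : C (p.1, Q').
  apply: (dirac_convex_order (x := x)) => //= [|k].
    by apply/(prob_expect1 Q' mK); rewrite hQ'// hK subr0; exact/(prob_expect1 _ mK).
  by rewrite hQ'// hk subr0.
have half : 0 < 2^-1 :> R by rewrite invr_gt0.
have half1 : 2^-1 < 1 :> R by lra.
(* [p.2] is the midpoint of [Q] and [Q'], so extremality gives [Q = p.2] on [A]. *)
have [||_] := extreme_expect ext CQ CQ' half half1 _ _ mA.
- by move=> f Df /=; lra.
- by move=> f Df /=; rewrite hQ// hQ'//; lra.
rewrite /= hQ; last exact: bounded_measurable_indic.
lra.
Qed.

End DiracExtreme.

(** * Extreme pairs *)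

Section Characterization.
Variables (R : realType) (n : nat) (K : set 'rV[R]_n).
Hypotheses (cK : compact K) (vK : convex_set K).
Local Notation T := (borelRn R n).
Local Notation V := 'rV[R]_n.
Local Notation D := (@bounded_measurable _ T R).
Local Notation C := (@convex_order_pairs R n K).
Implicit Types (p q r : borel_prob R n * borel_prob R n) (P Q : borel_prob R n).

Let mK : measurable (K : set T). Proof. exact: compact_borel. Qed.

Let Dcoord k : D (coord K k).
Proof.
exact: (convex_continuous_bounded_measurable cK (convex_continuous_coord K k)).
Qed.

Lemma dirac_expect P (x : T) :
  (forall A, measurable A -> P A = \d_x A) -> forall f, D f -> expect P f = f x.
Proof.
move=> Px f Df.
rewrite (@atomic_expect _ _ P 1 (fun=> x) (fun=> 1))//; first by rewrite big_ord1 mul1r.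
by move=> B mB; rewrite big_ord1 mul1e Px.
Qed.

(** By the zero-one law, one of two disjoint sets is null, so [finite_support] with [N = 1] leaves
    at most one atom. *)
Lemma extreme_first_dirac p : extreme_pairs C p ->
  exists2 x : V, K x & forall A : set T, measurable A -> p.1 A = \d_(x : T) A.
Proof.
move=> ext; have [/(convex_order_pairsP p cK)[p1K _ _] _] := ext.
have [|m [s [m1 _ Ks _ hs]]] := finite_support (N := 1) cK p1K.
  move=> A mA tA; have [|h0] := extreme_first_01 cK ext (mA ord0); first by exists ord0.
  exists ord_max; apply/eqP; rewrite -measure_le0.
  have : p.1 (~` A ord0) = 0%E.
    apply: etrans (probability_setC p.1 (mA ord0)) _.
    by rewrite h0 subee.
  move=> <-; apply: le_measure; rewrite ?inE//; first exact: measurableC.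
  move=> z z1 z0.
  by have := tA ord0 ord_max Logic.I Logic.I (ex_intro _ z (conj z0 z1)).
case: m s m1 Ks hs => [|[|//]] s _ Ks hs.
  by have := hs K mK; rewrite big_ord0 p1K => /eqP; rewrite onee_eq0.
exists (s ord0) => // A mA; rewrite hs// big_ord1.
have := hs setT measurableT; rewrite big_ord1 diracT mule1 probability_setT => <-.
by rewrite mul1e.
Qed.

(** The matrix [M] has one row more than it has columns, so some nonzero [c] satisfies [c *m M = 0].
    Then [h], equal to [c ord0 i] on [A i], satisfies the [n + 1] conditions, and [extreme_no_tilt]
    gives [c ord0 i * p.2 (A i) = 0] for every [i]. *)
Lemma disjoint_null p (x : V) (A : 'I_n.+2 -> set T) : extreme_pairs C p ->
  (forall f, D f -> expect p.1 f = f x) ->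
  (forall i, measurable (A i)) -> trivIset setT A -> exists i, p.2 (A i) = 0%E.
Proof.
move=> ext px mA tA.
(* Index 0 stands for the constant 1, the others for the coordinates. *)
pose phi (j : 'I_n.+1) : T -> R := oapp (coord K) (cst 1) (unlift ord0 j).
have Dphi j : D (phi j).
  rewrite /phi; case: unlift => [k|] /=; first exact: Dcoord.
  exact: bounded_measurable_cst.
have DA i : D \1_(A i) by exact: bounded_measurable_indic.
pose M := \matrix_(i < n.+2, j < n.+1) expect p.2 (\1_(A i) * phi j).
have : ~~ row_free M.
  by rewrite /row_free neq_ltn ltnS rank_leq_col.
rewrite -kermx_eq0 => ker0.
pose c := nz_row (kermx M).
have cn0 : c != 0 by rewrite nz_row_eq0.
have cM : c *m M = 0 by apply/sub_kermxP; exact: nz_row_sub.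
pose h : T -> R := \sum_i c ord0 i *: \1_(A i).
have Dh : D h by apply: bounded_measurable_sum => i; exact: bounded_measurableZ.
have hE f : D f -> expect p.2 (h * f) = \sum_i c ord0 i * expect p.2 (\1_(A i) * f).
  move=> Df; have [_ wZ] := expect_weighted_linear p.2 Df.
  rewrite mulrC (linear_on_sum _ (expect_weighted_linear p.2 Df)); last first.
    by move=> i; exact: bounded_measurableZ.
  by apply: eq_bigr => i _; rewrite wZ// [f * _]mulrC.
have hphi j : expect p.2 (h * phi j) = 0.
  rewrite hE//; have := congr1 (fun N : 'rV_n.+1 => N ord0 j) cM.
  rewrite [LHS]mxE [RHS]mxE => e; apply: etrans e.
  by apply: eq_bigr => i _; rewrite mxE.
have h0 : expect p.2 h = 0.
  have := hphi ord0; rewrite /phi unlift_none /= => <-.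
  by congr expect; exact: esym (mulr1 h).
have hk k : expect p.2 (h * coord K k) = 0.
  by have := hphi (lift ord0 k); rewrite /phi liftK.
have tilt0 := extreme_no_tilt cK vK ext px Dh h0 hk.
apply: contrapT => /forallNP nA; move/eqP: cn0; apply.
apply/rowP => i; rewrite mxE; have := tilt0 _ (mA i); rewrite hE//.
rewrite (bigD1 i)//= big1 ?addr0 => [|j ji].
  have -> : expect p.2 (\1_(A i) * \1_(A i)) = fine (p.2 (A i)).
    rewrite -expect_indic//; congr expect; apply/funext => z.
    change (\1_(A i) z * \1_(A i) z = \1_(A i) z :> R).
    by rewrite indicE; case: (z \in A i); rewrite ?mulr1 ?mulr0.
  move=> /eqP; rewrite mulf_eq0 => /orP[/eqP//|/eqP e0].
  by exfalso; apply: (nA i); rewrite fine_probE// e0.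
rewrite (_ : \1_(A j) * \1_(A i) = cst 0 :> (T -> R)) ?expect_cst ?mulr0//.
apply/funext => z; change (\1_(A j) z * \1_(A i) z = 0 :> R); rewrite !indicE.
have [|_] := boolP (z \in A j); last by rewrite mul0r.
have [|_] := boolP (z \in A i); last by rewrite mulr0.
rewrite !inE => zi zj; move/eqP: ji => []; apply: tA => //; by exists z.
Qed.

Lemma extreme_simplex p : extreme_pairs C p -> simplex_pairs K p.
Proof.
move=> ext; have [Cp _] := ext; have [p1K p2K _] := (convex_order_pairsP p cK).1 Cp.
have [x Kx px] := extreme_first_dirac ext.
have ex := dirac_expect px.
(* At most [n.+1] atoms; writing [m = d.+1], this is [d <= n]. *)
have [|m [s [mn sI Ks pos hs]]] := finite_support (N := n.+1) cK p2K.
  by move=> A mA tA; exact: disjoint_null ext ex mA tA.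
have es := atomic_expect hs (fun i => ltW (pos i)).
case: m s mn sI Ks pos hs es => [|d] s mn sI Ks pos hs es.
  by have := hs K mK; rewrite big_ord0 p2K => /eqP; rewrite onee_eq0.
pose l i := fine (p.2 [set s i]).
exists d, x, s, l; split; [split => //|split; [split => //|]].
- apply/affinely_independentP => c c0 cx i.
  (* Dividing by the masses gives [h] times [p.2] the weight [c j] at [s j], so the dependence [c]
     becomes an admissible tilt. *)
  pose h : T -> R := \sum_j (c j / l j) *: \1_([set s j] : set T).
  have Dind j : D \1_([set s j] : set T).
    by apply: bounded_measurable_indic; exact: set1_borel.
  have Dh : D h by apply: bounded_measurable_sum => j; exact: bounded_measurableZ.
  have hE j : l j * h (s j) = c j.
    have -> : h (s j) = c j / l j.
      rewrite /h fct_sumE (bigD1 j)//= big1 ?addr0 => [|k kj].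
        change (c j / l j * \1_([set s j] : set T) (s j) = c j / l j).
        by rewrite indicE mem_set// mulr1.
      change (c k / l k * \1_([set s k] : set T) (s j) = 0).
      by rewrite indicE memNset ?mulr0// => /= /sI e; rewrite e eqxx in kj.
    by rewrite mulrCA divff ?mulr1//; apply/lt0r_neq0/pos.
  have tilt0 f : D f -> expect p.2 (h * f) = \sum_j c j * f (s j).
    move=> Df; rewrite es; last exact: bounded_measurableM.
    apply: eq_bigr => j _; rewrite -hE.
    exact: mulrA.
  have := extreme_no_tilt cK vK ext ex Dh _ _ (set1_borel (s i)).
  rewrite tilt0// (bigD1 i)//= indicE mem_set// mulr1 big1 ?addr0; last first.
    move=> j ji; rewrite indicE memNset ?mulr0// => /= /sI e.
    by rewrite e eqxx in ji.
  apply.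
  + by rewrite es//; apply: etrans c0; apply: eq_bigr => j _; exact: hE.
  + move=> k; rewrite tilt0//; have := congr1 (fun y : V => y ord0 k) cx.
    rewrite summxE [RHS]mxE => e; apply: etrans e; apply: eq_bigr => j _.
    by rewrite mxE coordE.
- have := es (cst 1) (@bounded_measurable_cst _ T R 1).
  by rewrite expect_cst => ->; apply: eq_bigr => i _; rewrite mulr1.
- apply/rowP => k; rewrite -(coordE k Kx) -ex// -(convex_order_coord cK k Cp) es//.
  by rewrite summxE; apply: eq_bigr => i _; rewrite mxE coordE.
- by move=> A mA; split; [exact: px|exact: hs].
Qed.

Lemma simplex_convex_order p : simplex_pairs K p -> C p.
Proof.
move=> [d [x [xs [l [[_ Kxs _] [[l0 l1 xE] hp]]]]]].
have p1 A : measurable A -> p.1 A = \d_(x : T) A by move=> mA; have [] := hp A mA.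
have p2 A : measurable A -> p.2 A = (\sum_i (l i)%:E * \d_(xs i : T) A)%E.
  by move=> mA; have [] := hp A mA.
have e2 := atomic_expect p2 (fun i => ltW (l0 i)).
apply: (dirac_convex_order cK vK (x := x)); first exact: dirac_expect.
  apply/(prob_expect1 p.2 mK); rewrite e2; last exact: bounded_measurable_indic.
  by rewrite -l1; apply: eq_bigr => i _; rewrite indicE mem_set// mulr1.
move=> k; rewrite e2// xE summxE; apply: eq_bigr => i _.
by rewrite mxE coordE.
Qed.

(** 1 is an extreme point of the interval from 0 to 1. *)
Lemma mixture_full P Q Q' (t : R) (A : set T) : 0 < t -> t < 1 -> measurable A ->
  P A = (t%:E * Q A + (1 - t)%:E * Q' A)%E -> P A = 1%E -> Q A = 1%E.
Proof.
move=> t0 t1 mA + PA; rewrite PA (fine_probE Q mA) (fine_probE Q' mA).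
have le1 (S : borel_prob R n) : fine (S A) <= 1.
  by rewrite -lee_fin -fine_probE//; exact: probability_le1.
rewrite -!EFinM -EFinD => /eqP; rewrite eqe => /eqP e; congr EFin.
apply/eqP; rewrite eq_le le1/= -(ler_pM2l t0) mulr1.
have h : (1 - t) * fine (Q' A) <= (1 - t) * 1.
  by apply: ler_wpM2l => //; rewrite subr_ge0 ltW.
by lra.
Qed.

Lemma full_negligible P (A : set T) : measurable A -> P A = 1%E ->
  P.-negligible (~` A).
Proof.
move=> mA PA; apply/negligibleP; first exact: measurableC.
by apply: etrans (probability_setC P mA) _; rewrite PA subee.
Qed.

Lemma affinely_independent_inj m (xs : 'I_m -> V) :
  affinely_independent xs -> injective xs.
Proof.
move=> ind i j e; apply/eqP; apply: contraT => ij; exfalso; apply: (ind i).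
exists 1%N, (fun=> xs j), (fun=> 1); split.
- by move=> _; exists j => //=; rewrite eq_sym.
- by rewrite big_ord1.
- by rewrite big_ord1 scale1r.
Qed.

(** Sets of full [p]-mass have full [q]-mass, so [q.1] sits at [x] and [q.2] on the points [xs].
    Only the weights of [q.2] remain, and convex order fixes their barycentre. *)
Lemma simplex_rigid p q r (t : R) : simplex_pairs K p -> 0 < t -> t < 1 ->
  C q -> pair_mixture t q r p -> Defs.pair_eq q p.
Proof.
move=> sp t0 t1 Cq mix; have Cp := simplex_convex_order sp.
have [d [x [xs [l [[_ Kxs ind] [[l0 l1 xE] hp]]]]]] := sp.
have p1 A : measurable A -> p.1 A = \d_(x : T) A by move=> mA; have [] := hp A mA.
have p2 A : measurable A -> p.2 A = (\sum_i (l i)%:E * \d_(xs i : T) A)%E.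
  by move=> mA; have [] := hp A mA.
have xsI := affinely_independent_inj ind.
have q1 A : measurable A -> q.1 A = \d_(x : T) A.
  have qx : q.1 [set x] = 1%E.
    have [h _] := mix _ (set1_borel (x : T)).
    apply: (mixture_full t0 t1 (set1_borel _) h).
    by rewrite p1 ?diracE ?mem_set//; exact: set1_borel.
  move=> mA; have xI : injective (fun _ : 'I_1 => x : T) by move=> i j; rewrite !ord1.
  rewrite (atomic_measure xI _ mA); first by rewrite big_ord1 qx mul1e.
  rewrite (_ : range _ = [set x]); first exact: (full_negligible (set1_borel _) qx).
  by apply/seteqP; split => z; [case=> _ _ <-|move=> ->; exists ord0].
have mr : measurable (range xs : set T).
  rewrite (_ : range xs = \big[setU/set0]_(i < d.+1) ([set xs i] : set T)).
    by apply: bigsetU_measurable => i _; exact: set1_borel.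
  rewrite -bigcup_seq; apply/seteqP; split => z.
    by case=> i _ <-; exists i => //; exact: mem_index_enum.
  by case=> i _ /= ->; exists i.
have qr : q.2 (range xs : set T) = 1%E.
  have [_ h] := mix _ mr.
  apply: (mixture_full t0 t1 mr h); rewrite p2//.
  rewrite (eq_bigr (fun i => (l i)%:E)) ?sumEFin ?l1// => i _.
  by rewrite diracE mem_set ?mule1//; exists i.
have q2 := atomic_measure xsI (full_negligible mr qr).
pose w i := fine (q.2 [set xs i]).
have q2' A : measurable A -> q.2 A = (\sum_i (w i)%:E * \d_(xs i : T) A)%E.
  move=> mA; rewrite q2//; apply: eq_bigr => i _.
  by rewrite -fine_probE//; exact: set1_borel.
have w0 i : 0 <= w i by exact: fine_ge0.
have ew := atomic_expect q2' w0.
have el := atomic_expect p2 (fun i => ltW (l0 i)).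
(* Both weight families sum to 1 and have barycentre [x], so their difference is an affine
   dependence of the [xs]. *)
have wl : forall i, w i - l i = 0.
  apply: (affinely_independentP xs).1 => //.
    rewrite sumrB l1; have := ew (cst 1) (@bounded_measurable_cst _ T R 1).
    rewrite expect_cst; under eq_bigr do rewrite mulr1.
    by move=> <-; rewrite subrr.
  apply/rowP => k; rewrite summxE mxE.
  have := convex_order_coord cK k Cq.
  rewrite (dirac_expect q1)// -(dirac_expect p1)// -(convex_order_coord cK k Cp).
  rewrite ew// el// => /eqP; rewrite -subr_eq0 -sumrB => /eqP e.
  by apply: etrans e; apply: eq_bigr => i _; rewrite mxE coordE// mulrBl.
move=> A mA; split; first by rewrite q1// p1.
rewrite q2'// p2//; apply: eq_bigr => i _.
by have /eqP := wl i; rewrite subr_eq0 => /eqP ->.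
Qed.

Lemma simplex_extreme p : simplex_pairs K p -> extreme_pairs C p.
Proof.
move=> sp; split; first exact: simplex_convex_order.
move=> t q r t0 t1 Cq Cr mix; split; first exact: simplex_rigid mix.
(* The second component is handled by exchanging [q] and [r], with [1 - t] for [t]. *)
apply: (@simplex_rigid p r q (1 - t)) => //; [lra|lra|move=> A mA].
have [-> ->] := mix A mA; rewrite opprB addrCA subrr addr0.
by split; rewrite addeC.
Qed.

End Characterization.

Theorem theorem3p1 (R : realType) (n : nat) (K : set 'rV[R]_n) :
  convex_body K ->
  extreme_pairs (convex_order_pairs K) = simplex_pairs K.
Proof.
move=> [vK cK _]; apply/seteqP; split => p.
  exact: extreme_simplex.
exact: simplex_extreme.
Qed.
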